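(* Let $F$ be a non-trivial definably closed ID-field (inside $\mathcal{U}$) with algebraically closed constant field $C_F$, let $G$ be an algebraic group defined over $C_F$, and let $\ell D(x)=\alpha$ be a consistent logarithmic differential equation over $F$, i.e. $\alpha\in\mathbb{A}G_e(F)$ lies in the image of $\ell D\colon G(\mathcal{U})\to\mathbb{A}G_e(\mathcal{U})$. Then there exists an iterative differential Galois extension of $F$ for this equation, and any two such extensions are isomorphic over $F$ as ID-fields.
   Context: Fix a prime $p$. An iterative derivation on a ring $R$ is a sequence $\partial=(\partial_i)_{i\in\omega}$ of maps $R\to R$ with $\partial_0=\mathrm{id}$, such that $\mathbb{D}_\partial\colon R\to R[[\epsilon]]$, $x\mapsto\sum_i\partial_i(x)\epsilon^i$ is a ring homomorphism and $\partial_i\circ\partial_j=\binom{i+j}{i}\partial_{i+j}$. An ID-field is a field with an iterative derivation; its constant field $C_F$ is where all $\partial_i$, $i\ge1$, vanish; non-trivial means $\partial_1\not\equiv0$. $\mathcal{U}$ is a large saturated model of $SCH_p$ (separably closed ID-fields $K$ of characteristic $p$ with $[K:K^p]=p$, $K^p=\ker\partial_1$) containing all ID-fields considered, with constant field $\mathcal{C}$. For $A\subseteq\mathcal{U}$, $F\langle A\rangle$ is the ID-subfield generated by $F\cup A$, and $B^s$ the closure of $B$ under $p$-th roots in $\mathcal{U}$; $\operatorname{dcl}(A)=\langle A\rangle^s$ and $F$ definably closed means $\operatorname{dcl}(F)=F$. Arc bundles: for a variety $X$ and field $k$, $\mathbb{A}X(k)=X(k[[\epsilon]])$ (the inverse limit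 of $X(k[\epsilon]/(\epsilon^{m+1}))$); for an algebraic group $G$ this is a group, $\pi\colon\mathbb{A}G\to G$ is reduction mod $\epsilon$, $\mathbb{A}G_e=\ker\pi$, and $s\colon G\to\mathbb{A}G$ is the inclusion $G(k)\subseteq G(k[[\epsilon]])$, written $g\mapsto(g,0,0,\dots)$. Let $h\colon\mathbb{A}G\to\mathbb{A}G_e$, $h(x)=x\cdot s(\pi(x))^{-1}$. For $g\in G(\mathcal{U})$, $\nabla(g)=(\partial_0 g,\partial_1 g,\dots)\in\mathbb{A}G(\mathcal{U})$ is the image of $g$ under $\mathbb{D}_\partial$. The iterative logarithmic derivative is $\ell D(g)=h(\nabla(g))$. An iterative differential Galois extension of $F$ for $\ell D(x)=\alpha$ is an ID-field $K=F\langle a\rangle^s\subseteq\mathcal{U}$ with $a\in G(\mathcal{U})$, $\ell D(a)=\alpha$ and $C_K=C_F$. *)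

(* Defs.v *)
From HB Require Import structures.
From mathcomp Require Import all_boot all_order all_algebra.
From mathcomp Require Import separable.
From mathcomp Require Import boolp classical_sets functions cardinality.

Set Implicit Arguments.
Unset Strict Implicit.
Unset Printing Implicit Defensive.

Import GRing.Theory.

Local Open Scope ring_scope.
Local Open Scope classical_set_scope.

(* A record rather than [nat -> R], which already carries a pointwise ring
   structure. *)
Record fps (R : Type) := Fps { coef : nat -> R }.

HB.instance Definition _ (R : Type) := gen_eqMixin (fps R).
HB.instance Definition _ (R : Type) := gen_choiceMixin (fps R).

Lemma fpsP (R : Type) (f g : fps R) : coef f =1 coef g -> f = g.
Proof. by case: f g => [f] [g] /= /funext ->. Qed.

Section FpsRing.
Variable R : comPzRingType.
Implicit Types f g h : fps R.

Definition fps_const (c : R) : fps R := Fps (fun n => if n is 0%N then c else 0).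
Definition fps_add f g : fps R := Fps (fun n => coef f n + coef g n).
Definition fps_opp f : fps R := Fps (fun n => - coef f n).
Definition fps_mul f g : fps R :=
  Fps (fun n => \sum_(i < n.+1) coef f i * coef g (n - i)%N).

Fact fps_addA : associative fps_add.
Proof. by move=> f g h; apply: fpsP => n /=; rewrite addrA. Qed.

Fact fps_addC : commutative fps_add.
Proof. by move=> f g; apply: fpsP => n /=; rewrite addrC. Qed.

Fact fps_add0 : left_id (fps_const 0) fps_add.
Proof. by move=> f; apply: fpsP => -[|n] /=; rewrite add0r. Qed.

Fact fps_addN : left_inverse (fps_const 0) fps_opp fps_add.
Proof. by move=> f; apply: fpsP => -[|n] /=; rewrite addNr. Qed.

HB.instance Definition _ :=
  GRing.isZmodule.Build (fps R) fps_addA fps_addC fps_add0 fps_addN.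

Fact fps_mulC : commutative fps_mul.
Proof.
move=> f g; apply: fpsP => n /=; rewrite (reindex_inj rev_ord_inj) /=.
by apply: eq_bigr => i _; rewrite !subSS subKn ?leq_ord // mulrC.
Qed.

Fact fps_mulA : associative fps_mul.
Proof.
move=> f g h; rewrite [RHS]fps_mulC; apply: fpsP => n /=.
pose c3 j k := coef f j * (coef g (n - j - k)%N * coef h k).
transitivity (\sum_(j < n.+1) \sum_(k < n.+1 | (k <= n - j)%N) c3 j k).
  apply: eq_bigr => j _.
  rewrite -[(\sum_(i < _) _)]/(coef (fps_mul g h) (n - j)) fps_mulC /= big_distrr.
  rewrite (big_ord_narrow_leq (leq_subr _ _)) /=.
  by apply: eq_bigr => k _; rewrite /c3 [_ * coef h k]mulrC.
rewrite (exchange_big_dep predT) //=; apply: eq_bigr => k _.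
transitivity (\sum_(j < n.+1 | (j <= n - k)%N) c3 j k).
  apply: eq_bigl => j; rewrite -ltnS -(ltnS j) -!subSn ?leq_ord //.
  by rewrite -subn_gt0 -(subn_gt0 j) -!subnDA addnC.
rewrite (big_ord_narrow_leq (leq_subr _ _)) big_distrr /=.
apply: eq_bigr => j _.
by rewrite /c3 -!subnDA addnC mulrA [_ * coef h k]mulrC.
Qed.

Fact fps_mul1 : left_id (fps_const 1) fps_mul.
Proof.
move=> f; apply: fpsP => n /=; rewrite big_ord_recl /= mul1r subn0.
by rewrite big1 ?addr0 // => i _; rewrite mul0r.
Qed.

Fact fps_mulDl : left_distributive fps_mul fps_add.
Proof.
move=> f g h; apply: fpsP => n /=.
by rewrite -big_split; apply: eq_bigr => i _; rewrite mulrDl.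
Qed.

HB.instance Definition _ := GRing.Zmodule_isComPzRing.Build (fps R)
  fps_mulA fps_mulC fps_mul1 fps_mulDl.

Definition fps_coef0 f : R := coef f 0.

Fact fps_coef0_zmod : zmod_morphism fps_coef0.
Proof. by []. Qed.

Fact fps_coef0_monoid : monoid_morphism fps_coef0.
Proof. by split=> // f g; rewrite /fps_coef0 /= big_ord1. Qed.

HB.instance Definition _ :=
  GRing.isZmodMorphism.Build (fps R) R fps_coef0 fps_coef0_zmod.
HB.instance Definition _ :=
  GRing.isMonoidMorphism.Build (fps R) R fps_coef0 fps_coef0_monoid.

Fact fps_const_zmod : zmod_morphism fps_const.
Proof. by move=> a b; apply: fpsP => -[|n] //=; rewrite subrr. Qed.

Fact fps_const_monoid : monoid_morphism fps_const.
Proof.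
split=> // a b; apply: fpsP => n /=; rewrite big_ord_recl big1 => [|i _].
  by case: n => [|n] /=; rewrite addr0 ?mulr0.
by rewrite mul0r.
Qed.

HB.instance Definition _ :=
  GRing.isZmodMorphism.Build R (fps R) fps_const fps_const_zmod.
HB.instance Definition _ :=
  GRing.isMonoidMorphism.Build R (fps R) fps_const fps_const_monoid.

End FpsRing.

Section FpsMap.
Variables (R S : comPzRingType) (phi : {rmorphism R -> S}).

Definition fps_map (f : fps R) : fps S := Fps (fun n => phi (coef f n)).

Fact fps_map_zmod : zmod_morphism fps_map.
Proof. by move=> f g; apply: fpsP => n /=; rewrite rmorphB. Qed.

Fact fps_map_monoid : monoid_morphism fps_map.
Proof.
split=> [|f g]; apply: fpsP => n /=.
  by case: n => [|n]; rewrite ?rmorph1 ?rmorph0.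
by rewrite rmorph_sum; apply: eq_bigr => i _; rewrite rmorphM.
Qed.

HB.instance Definition _ :=
  GRing.isZmodMorphism.Build (fps R) (fps S) fps_map fps_map_zmod.
HB.instance Definition _ :=
  GRing.isMonoidMorphism.Build (fps R) (fps S) fps_map fps_map_monoid.

End FpsMap.

HB.mixin Record hasIterativeDerivation R of GRing.ComNzRing R := {
  ider : nat -> R -> R;
  ider0 : forall x, ider 0%N x = x;
  ider_zmod : zmod_morphism (fun x => Fps (ider^~ x) : fps R);
  ider_monoid : monoid_morphism (fun x => Fps (ider^~ x) : fps R);
  ider_comp : forall i j x, ider i (ider j x) = ider (i + j)%N x *+ 'C(i + j, i)
}.

#[short(type="idRingType")]
HB.structure Definition IDRing :=
  {R of GRing.ComNzRing R & hasIterativeDerivation R}.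

#[short(type="idFieldType")]
HB.structure Definition IDField :=
  {K of GRing.Field K & hasIterativeDerivation K}.

Section Expansion.
Variable R : idRingType.

Definition expD (x : R) : fps R := Fps (ider^~ x).

HB.instance Definition _ :=
  GRing.isZmodMorphism.Build R (fps R) expD (@ider_zmod R).
HB.instance Definition _ :=
  GRing.isMonoidMorphism.Build R (fps R) expD (@ider_monoid R).

Lemma iderB i : zmod_morphism (@ider R i).
Proof. by move=> x y; have /(congr1 (fun f : fps R => coef f i)) := rmorphB expD x y. Qed.

HB.instance Definition _ i := GRing.isZmodMorphism.Build R R (@ider R i) (iderB i).

Lemma iderM i (x y : R) :
  ider i (x * y) = \sum_(j < i.+1) ider j x * ider (i - j)%N y.
Proof. by have /(congr1 (fun f : fps R => coef f i)) := rmorphM expD x y. Qed.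

Lemma ider1 i : (0 < i)%N -> ider i (1 : R) = 0.
Proof.
by case: i => // i _; have /(congr1 (fun f : fps R => coef f i.+1)) := rmorph1 expD.
Qed.

End Expansion.

(* [K : divringClosed U] is the library's structure for a subfield of [U]. *)
Section Subfield.
Variables (U : fieldType) (K : divringClosed U).

Definition subfieldType := {x : U | x \in K}.

HB.instance Definition _ := SubChoice.on subfieldType.
HB.instance Definition _ := [SubChoice_isSubIntegralDomain of subfieldType by <:].
HB.instance Definition _ := [SubIntegralDomain_isSubField of subfieldType by <:].

End Subfield.

Section SubfieldInclusion.
Variables (U : fieldType) (K L : divringClosed U) (KL : {subset K <= L}).

Definition sub_incl (x : subfieldType K) : subfieldType L :=
  Sub (val x) (KL (valP x)).

Fact sub_incl_zmod : zmod_morphism sub_incl.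
Proof. by move=> x y; apply: val_inj; rewrite rmorphB. Qed.

Fact sub_incl_monoid : monoid_morphism sub_incl.
Proof. by split=> [|x y]; apply: val_inj; rewrite ?rmorph1 ?rmorphM. Qed.

HB.instance Definition _ := GRing.isZmodMorphism.Build
  (subfieldType K) (subfieldType L) sub_incl sub_incl_zmod.
HB.instance Definition _ := GRing.isMonoidMorphism.Build
  (subfieldType K) (subfieldType L) sub_incl sub_incl_monoid.

End SubfieldInclusion.

Record idSubfield (U : idFieldType) := IDSubfield {
  idsub_pred :> divringClosed U;
  idsub_stable : forall i x, x \in idsub_pred -> ider i x \in idsub_pred
}.

Section IDSubfieldIsIDField.
Variables (U : idFieldType) (K : idSubfield U).
Local Notation KT := (subfieldType K).

Definition sub_ider (i : nat) (x : KT) : KT :=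
  Sub (ider i (val x)) (idsub_stable i (valP x)).

Fact sub_ider0 x : sub_ider 0 x = x.
Proof. by apply: val_inj => /=; rewrite ider0. Qed.

Fact sub_ider_zmod : zmod_morphism (fun x => Fps (sub_ider^~ x) : fps KT).
Proof.
move=> x y; apply: fpsP => i; apply: val_inj.
rewrite -[LHS]/(ider i (val (x - y))) rmorphB raddfB.
by rewrite -[RHS]/(val (sub_ider i x - sub_ider i y)) rmorphB.
Qed.

Fact sub_ider_monoid : monoid_morphism (fun x => Fps (sub_ider^~ x) : fps KT).
Proof.
split=> [|x y]; apply: fpsP => i; apply: val_inj.
  by case: i => [|i]; [exact: ider0 | exact: ider1].
rewrite -[LHS]/(ider i (val (x * y))) rmorphM iderM.
rewrite -[RHS]/(val (\sum_(j < i.+1) sub_ider j x * sub_ider (i - j) y)).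
by rewrite rmorph_sum; apply: eq_bigr => j _; rewrite rmorphM.
Qed.

Fact sub_ider_comp i j x :
  sub_ider i (sub_ider j x) = sub_ider (i + j) x *+ 'C(i + j, i).
Proof.
apply: val_inj; rewrite -[LHS]/(ider i (ider j (val x))) ider_comp.
by rewrite raddfMn.
Qed.

HB.instance Definition _ := hasIterativeDerivation.Build KT
  sub_ider0 sub_ider_zmod sub_ider_monoid sub_ider_comp.

End IDSubfieldIsIDField.

Section Constants.
Variables (U : idFieldType) (K : idSubfield U).

Definition constants : {pred U} :=
  fun x => (x \in K) && `[< forall i, (0 < i)%N -> ider i x = 0 >].

Lemma constantsP x :
  x \in constants <-> x \in K /\ forall i, (0 < i)%N -> ider i x = 0.
Proof.
split=> [/andP[xK /asboolP]|[xK cx]]; first by [].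
by apply/andP; split=> //; apply/asboolP.
Qed.

Fact constants_divring_closed : divring_closed constants.
Proof.
have cM (x y : U) : (forall i, (0 < i)%N -> ider i x = 0) ->
    forall i, ider i (x * y) = x * ider i y.
  move=> cx i; rewrite iderM big_ord_recl ider0 subn0 big1 ?addr0 // => j _.
  by rewrite cx ?mul0r.
split=> [|x y|x y].
- by apply/constantsP; split; [exact: rpred1 | exact: ider1].
- move=> /constantsP[xK cx] /constantsP[yK cy]; apply/constantsP.
  by split=> [|i i0]; rewrite ?rpredB // raddfB /= cx // cy // subrr.
- move=> /constantsP[xK cx] /constantsP[yK cy]; apply/constantsP.
  split=> [|i i0]; first by rewrite rpred_div.
  have [->|y0] := eqVneq y 0; first by rewrite invr0 mulr0 raddf0.
  by apply: (mulfI y0); rewrite -cM // mulrCA mulfV // mulr1 cx // mulr0.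
Qed.

HB.instance Definition _ :=
  GRing.isDivringClosed.Build U constants constants_divring_closed.

Definition constantField : divringClosed U := constants.

Lemma constants_sub : {subset constantField <= K}.
Proof. by move=> x /constantsP[]. Qed.

End Constants.

Section Generation.
Variable U : idFieldType.

Definition idgen (A : set U) : set U :=
  [set x | forall K : idSubfield U, A `<=` [set` K] -> x \in K].

(* [B^s], i.e. the least superset of [B] closed under [p]-th roots *)
Definition proot_closure (p : nat) (B : set U) : set U :=
  [set x | exists n : nat, B (x ^+ (p ^ n)%N)].

Definition dcl (p : nat) (A : set U) : set U := proot_closure p (idgen A).

End Generation.

Definition separably_closed (K : fieldType) : Prop :=
  forall q : {poly K}, (1 < size q)%N -> separable_poly q -> exists x, root q x.

(* [K : K^p] = p: there is a basis of [K] over [K^p] with [p] elements *)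
Definition imperfection_degree_one (p : nat) (K : fieldType) : Prop :=
  exists b : 'I_p -> K, forall x : K,
    exists! c : {ffun 'I_p -> K},
      (forall i, exists y, c i = y ^+ p) /\ x = \sum_(i < p) c i * b i.

Record SCH (p : nat) (K : idFieldType) : Prop := {
  SCH_char : p \in [pchar K];
  SCH_closed : separably_closed K;
  SCH_degree : imperfection_degree_one p K;
  SCH_strict : forall x : K, ider 1 x = 0 <-> exists y, x = y ^+ p
}.

Inductive idTerm (V : Type) : Type :=
| TVar of V
| TZero
| TOne
| TAdd of idTerm V & idTerm V
| TOpp of idTerm V
| TMul of idTerm V & idTerm V
| TDer of nat & idTerm V.

(* [idFormula V] has its free variables in [V]; [FExists] binds [None]. *)
Inductive idFormula : Type -> Type :=
| FEq (V : Type) : idTerm V -> idTerm V -> idFormula V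
| FNot (V : Type) : idFormula V -> idFormula V
| FAnd (V : Type) : idFormula V -> idFormula V -> idFormula V
| FExists (V : Type) : idFormula (option V) -> idFormula V.

Section Semantics.
Variable U : idRingType.

Fixpoint teval (V : Type) (e : V -> U) (t : idTerm V) : U :=
  match t with
  | TVar v => e v
  | TZero => 0
  | TOne => 1
  | TAdd t1 t2 => teval e t1 + teval e t2
  | TOpp t1 => - teval e t1
  | TMul t1 t2 => teval e t1 * teval e t2
  | TDer i t1 => ider i (teval e t1)
  end.

Fixpoint holds (V : Type) (phi : idFormula V) : (V -> U) -> Prop :=
  match phi in idFormula W return (W -> U) -> Prop with
  | FEq W t1 t2 => fun e => teval e t1 = teval e t2
  | FNot W phi1 => fun e => ~ holds phi1 e
  | FAnd W phi1 phi2 => fun e => holds phi1 e /\ holds phi2 e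
  | FExists W phi1 => fun e => exists x : U, holds phi1 (oapp e x)
  end.

(* A formula in one variable over [A] has its free variables in [option A]:
   [None] is the variable and [Some a] the parameter [a]. *)
Definition realizes (A : set U) (x : U) (phi : idFormula (option {a : U | A a})) :=
  holds phi (oapp sval x).

(* |A| < |U| *)
Definition smaller (A : set U) : Prop := ~ ([set: U] #<= A)%card.

Definition saturated : Prop :=
  forall A : set U, smaller A ->
  forall q : set (idFormula (option {a : U | A a})),
    (forall (n : nat) (s : 'I_n -> idFormula (option {a : U | A a})),
       (forall i, q (s i)) -> exists x, forall i, realizes x (s i)) ->
    exists x, forall phi, q phi -> realizes x phi.

End Semantics.

(* Commutative algebras as rings under [k]; the zero ring is allowed. *)
Record alg (k : fieldType) := Alg {
  alg_ring :> comPzRingType;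
  alg_str : {rmorphism k -> alg_ring}
}.

Record ahom (k : fieldType) (A B : alg k) := AHom {
  ahom_fun :> {rmorphism A -> B};
  ahom_str : forall c, ahom_fun (alg_str A c) = alg_str B c
}.

Definition ahom_id (k : fieldType) (A : alg k) : ahom A A :=
  @AHom k A A idfun (fun _ => erefl).

Definition ahom_comp (k : fieldType) (A B C : alg k) (g : ahom B C)
    (f : ahom A B) : ahom A C :=
  @AHom k A C (g \o f)
    (fun c => etrans (congr1 g (ahom_str f c)) (ahom_str g c)).

Section AlgProperties.
Variable k : fieldType.

Definition finitely_generated (A : alg k) : Prop :=
  exists (n : nat) (s : 'I_n -> A), forall S : set A,
    (forall c, S (alg_str A c)) -> (forall i, S (s i)) ->
    (forall x y, S x -> S y -> S (x + y)) ->
    (forall x y, S x -> S y -> S (x * y)) -> forall x, S x.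

Definition reduced (A : alg k) : Prop :=
  forall (x : A) (n : nat), x ^+ n = 0 -> x = 0.

Definition generates_unit_ideal (B : alg k) (S : set B) : Prop :=
  exists (n : nat) (s c : 'I_n -> B),
    (forall i, S (s i)) /\ \sum_(i < n) c i * s i = 1.

(* [phi] exhibits [B] as the localization of [A] at the powers of [f] *)
Definition is_localization (A B : alg k) (f : A) (phi : ahom A B) : Prop :=
  [/\ exists v : B, phi f * v = 1,
      forall b : B, exists (n : nat) (a : A), phi f ^+ n * b = phi a
    & forall a : A, phi a = 0 -> exists n : nat, f ^+ n * a = 0].

End AlgProperties.

Record functor (k : fieldType) := Functor {
  fobj :> alg k -> Type;
  fmap : forall A B : alg k, ahom A B -> fobj A -> fobj B;
  fmap_id : forall (A : alg k) (x : fobj A), fmap (ahom_id A) x = x;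
  fmap_comp : forall (A B C : alg k) (g : ahom B C) (f : ahom A B) (x : fobj A),
    fmap (ahom_comp g f) x = fmap g (fmap f x)
}.

Section Schemes.
Variables (k : fieldType) (X : functor k).

Definition zariski_sheaf : Prop :=
  forall (A : alg k) (n : nat) (f : 'I_n -> A),
    generates_unit_ideal (range f) ->
  forall (B : 'I_n -> alg k) (rho : forall i, ahom A (B i)),
    (forall i, is_localization (f i) (rho i)) ->
  forall (B2 : 'I_n -> 'I_n -> alg k)
    (sigma : forall i j, ahom (B i) (B2 i j))
    (tau : forall i j, ahom (B j) (B2 i j)),
    (forall i j a, sigma i j (rho i a) = tau i j (rho j a)) ->
    (forall i j, is_localization (f i * f j) (ahom_comp (sigma i j) (rho i))) ->
  forall x : (forall i, X (B i)),
    (forall i j, fmap (sigma i j) (x i) = fmap (tau i j) (x j)) ->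
  exists! y : X A, forall i, fmap (rho i) y = x i.

(* For every [x : Spec A -> X], the preimage of [V] is the open subscheme
   of [Spec A] complementary to the zero locus of some [I]. *)
Definition open_subfunctor (V : forall B, set (X B)) : Prop :=
  forall (A : alg k) (x : X A), exists I : set A,
  forall (B : alg k) (phi : ahom A B),
    V B (fmap phi x) <-> generates_unit_ideal (phi @` I).

(* By Yoneda, [u : X A] is a morphism [Spec A -> X]; it is an open immersion. *)
Definition affine_open (A : alg k) (u : X A) : Prop :=
  (forall (B : alg k) (phi psi : ahom A B), fmap phi u = fmap psi u -> phi =1 psi)
  /\ open_subfunctor (fun B => range (fun phi : ahom A B => fmap phi u)).

(* A reduced scheme of finite type over [k], given by its functor of points.
   Over an algebraically closed [k], reduced means geometrically reduced. *)
Definition variety : Prop :=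
  zariski_sheaf /\
  exists (n : nat) (A : 'I_n -> alg k) (u : forall i, X (A i)),
    (forall i, [/\ finitely_generated (A i), reduced (A i) & affine_open (u i)])
    /\ forall (L : fieldType) (rho : {rmorphism k -> L}) (x : X (Alg rho)),
         exists (i : 'I_n) (phi : ahom (A i) (Alg rho)), fmap phi (u i) = x.

(* The coordinates of a point [a]: the values at [a] of the regular functions
   on the affine opens containing [a].  The field they generate over [k] is
   the one generated by the coordinates of [a] in any single affine chart. *)
Definition coordinates (B : alg k) (a : X B) : set B :=
  [set c | exists (A : alg k) (u : X A) (phi : ahom A B),
     [/\ affine_open u, fmap phi u = a & exists f : A, phi f = c]].

End Schemes.

Record group_functor (k : fieldType) := GroupFunctor {
  gobj : alg k -> groupType;
  gmap : forall A B : alg k, ahom A B -> gobj A -> gobj B;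
  gmap_id : forall (A : alg k) (x : gobj A), gmap (ahom_id A) x = x;
  gmap_comp : forall (A B C : alg k) (g : ahom B C) (f : ahom A B) (x : gobj A),
    gmap (ahom_comp g f) x = gmap g (gmap f x);
  gmapM : forall (A B : alg k) (f : ahom A B) (x y : gobj A),
    gmap f (x * y)%g = (gmap f x * gmap f y)%g
}.

Definition points (k : fieldType) (G : group_functor k) : functor k :=
  Functor (@gmap_id k G) (@gmap_comp k G).

(* No separatedness condition: a group scheme over a field is separated. *)
Record algebraic_group (k : fieldType) := AlgebraicGroup {
  ag_functor :> group_functor k;
  ag_variety : variety (points ag_functor)
}.

Section Arcs.
Variable k : fieldType.

Definition arc_alg (A : alg k) : alg k :=
  @Alg k (fps A) (@fps_const A \o alg_str A).

Definition arc_red (A : alg k) : ahom (arc_alg A) A :=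
  @AHom k (arc_alg A) A (@fps_coef0 A) (fun _ => erefl).

Definition arc_incl (A : alg k) : ahom A (arc_alg A) :=
  @AHom k A (arc_alg A) (@fps_const A) (fun _ => erefl).

Fact arc_map_str (A B : alg k) (phi : ahom A B) c :
  fps_map phi (alg_str (arc_alg A) c) = alg_str (arc_alg B) c.
Proof.
by apply: fpsP => -[|n] /=; rewrite ?ahom_str ?rmorph0.
Qed.

Definition arc_map (A B : alg k) (phi : ahom A B) : ahom (arc_alg A) (arc_alg B) :=
  @AHom k (arc_alg A) (arc_alg B) (fps_map phi) (arc_map_str phi).

Variable G : group_functor k.

Definition arc_bundle (A : alg k) : groupType := gobj G (arc_alg A).

Definition arc_pi (A : alg k) : arc_bundle A -> gobj G A := gmap (arc_red A).

Definition arc_s (A : alg k) : gobj G A -> arc_bundle A := gmap (arc_incl A).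

Definition arc_e (A : alg k) : set (arc_bundle A) := [set x | arc_pi x = 1%g].

Definition arc_h (A : alg k) (x : arc_bundle A) : arc_bundle A := (x * (arc_s (arc_pi x))^-1)%g.

End Arcs.

Section LogarithmicDerivative.
Variables (U : idFieldType) (F : idSubfield U).
Local Notation C_F := (constantField F).
Local Notation k := (subfieldType C_F).

Definition univ_alg : alg k := @Alg k U (val : k -> U).

Definition base_alg : alg k :=
  @Alg k (subfieldType F) (sub_incl (@constants_sub U F)).

Definition base_incl : ahom base_alg univ_alg :=
  @AHom k base_alg univ_alg (val : subfieldType F -> U) (fun _ => erefl).

Fact expD_str (c : k) : expD (alg_str univ_alg c) = alg_str (arc_alg univ_alg) c.
Proof.
have /constantsP[_ cc] := valP c.
by apply: fpsP => -[|i] /=; [exact: ider0 | rewrite cc].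
Qed.

Definition expD_hom : ahom univ_alg (arc_alg univ_alg) :=
  @AHom k univ_alg (arc_alg univ_alg) (@expD U) expD_str.

Variable G : algebraic_group k.

Definition nabla (g : gobj G univ_alg) : arc_bundle G univ_alg := gmap expD_hom g.

Definition logD (g : gobj G univ_alg) : arc_bundle G univ_alg := arc_h (nabla g).

Definition arc_base_incl : arc_bundle G base_alg -> arc_bundle G univ_alg :=
  gmap (arc_map base_incl).

Definition solves (alpha : arc_bundle G base_alg) (a : gobj G univ_alg) : Prop :=
  logD a = arc_base_incl alpha.

Definition consistent (alpha : arc_bundle G base_alg) : Prop := exists a, solves alpha a.

Definition idGalois_extension (p : nat) (alpha : arc_bundle G base_alg)
    (K : idSubfield U) : Prop :=
  exists a : gobj G univ_alg,
    [/\ solves alpha a,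
        [set` K] = proot_closure p
                     (idgen ([set` F] `|` coordinates (X := points G) a))
      & constants K =i constants F].

Definition idIsomorphic_over (K L : idSubfield U) : Prop :=
  exists sigma : {rmorphism subfieldType K -> subfieldType L},
    [/\ bijective sigma,
        forall i x, sigma (ider i x) = ider i (sigma x)
      & forall x : subfieldType K, val x \in F -> val (sigma x) = val x].

End LogarithmicDerivative.

(* Main.v *)
(* Idea.  Over an affine chart [A] of [G] the derivatives of the coordinates of
   a solution are given by fixed elements of [F (x) A] (uniform_derivative), so a
   specialization over [F] between two solutions commutes with the derivations.
   Any point [x] of [G] over an extension of [K] which kills all derivatives of
   some relations [h (a x)] can be replaced by a constant point: an expansion of
   [h (a x)] with coefficients in [K] that are independent over the constants has
   all its constant components vanishing at [x] (Wronskian argument), and these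
   have a zero over the algebraically closed constant field (Nullstellensatz).
   Existence: by noetherianity there is a solution [b] that is maximal for
   specialization.  A new constant [gamma] of [F(b)] is transcendental over [F], so
   it specializes to some [gamma0] in [C_F] along a point of the closure of [b];
   replacing that point by a constant translate of [b] contradicts maximality.
   Uniqueness: if [a], [b] generate Galois extensions, then [b] specializes to some
   [a w] and [a w] to some [b v] with [w], [v] in [G(C_F)]; the chain [b v^n] is
   stationary, so [b] and [a w] satisfy the same relations over [F], and
   the resulting isomorphism extends uniquely to fractions and p-th roots. *)

Require Import Defs.
From HB Require Import structures.
From mathcomp Require Import all_boot all_order all_algebra.
From mathcomp Require Import separable fieldext.
From mathcomp Require Import boolp classical_sets functions cardinality.

Set Implicit Arguments.
Unset Strict Implicit.
Unset Printing Implicit Defensive.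

Import GRing.Theory.

Local Open Scope ring_scope.

(** * Extending homomorphisms to finitely generated algebras *)

(** [G] is known only as a functor on algebras, and no tensor product or presentation is built. An
    element of [K (x) A] is a formal sum, seen through its values at pairs of points; where [G] must
    be evaluated at a ring of generic points, that ring consists of functions on a set of points.
    Hence the statements that choose formal sums first and quantify over points afterwards. The
    obstacle is that a specialization of a solution need not be a solution. Writing it as [a0 * x]
    helps because [x] is to become constant: differentiating a relation in [x] then touches its
    coefficients only, so the system of all derivatives is linear over the constants. The field [K]
    of coefficients must have algebraically closed constants. In the uniqueness proof it is the
    given extension, whose constants are those of [F]. In the existence proof the constants of the
    generated field are still unknown, so [K] is all of [U], whose constants have to be shown
    algebraically closed from the axioms of [SCH]. *)

Lemma ex_minimal (T : Type) (P : T -> Prop) (m : T -> nat) :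
  (exists x, P x) -> exists x, P x /\ forall y, P y -> (m x <= m y)%N.
Proof.
move=> [x0 Px0].
have ex : exists n, `[< exists x, P x /\ m x = n >].
  by exists (m x0); apply/asboolP; exists x0.
case: (ex_minnP ex) => n /asboolP[x [Px <-]] minn; exists x; split=> // y Py.
by apply: minn; apply/asboolP; exists y.
Qed.

(** In use [B] is a polynomial ring mapped to a field, where leading coefficients are not units;
    each round multiplies by [lead_coef q] once and cancels the top term. *)
Lemma pseudo_division (B : comNzRingType) (p q : {poly B}) : q != 0 ->
  exists N s r, lead_coef q ^+ N *: p = s * q + r /\ (size r < size q)%N.
Proof.
move=> q0; have [n] := ubnP (size p); elim: n p => // n IH p /ltnSE szp.
have [szpq|szqp] := ltnP (size p) (size q).
  by exists 0, 0, p; rewrite expr0 scale1r mul0r add0r.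
pose p1 := lead_coef q *: p - (lead_coef p *: 'X^(size p - size q)) * q.
have q_gt0 : (0 < size q)%N by rewrite size_poly_gt0.
have szp1 : (size p1 < n)%N.
  apply: leq_trans szp; have p_gt0 := leq_trans q_gt0 szqp.
  rewrite -(prednK p_gt0) ltnS; apply/leq_sizeP => j szj.
  rewrite coefB coefZ -scalerAl coefZ coefXnM.
  have Ej : (size p - size q <= size p - 1)%N by rewrite leq_sub2l.
  rewrite subn1 in Ej; rewrite ltnNge (leq_trans Ej szj) /=.
  have [->|nj] := eqVneq j (size p).-1.
    have -> : ((size p).-1 - (size p - size q) = (size q).-1)%N.
      by rewrite -!subn1 subnAC subKn.
    by rewrite -!lead_coefE mulrC subrr.
  have szj' : (size p <= j)%N by rewrite -(prednK p_gt0) ltn_neqAle eq_sym nj.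
  rewrite [p`_j]nth_default // mulr0 nth_default ?mulr0 ?subr0 //.
  by rewrite -[X in (X <= _)%N](subKn szqp) leq_sub2r.
have [N [s [r [E szr]]]] := IH p1 szp1.
exists N.+1, (s + lead_coef q ^+ N *: (lead_coef p *: 'X^(size p - size q))), r.
split=> //; move: E; rewrite /p1 scalerBr [_ *: (lead_coef q *: p)]scalerA -exprSr => /eqP.
rewrite subr_eq => /eqP ->. by rewrite mulrDl -!scalerAl addrAC.
Qed.

Section ExtensionStep.
Variables (B : comNzRingType) (E : fieldType) (iota : {rmorphism B -> E}) (x : E).

Let im (p : {poly B}) := map_poly iota p.

(** The kernel of [iota] is never divided out. Truncating a representative lets its leading
    coefficient survive [iota], as pseudo-division by it requires. *)
Lemma trim_poly (p : {poly B}) : exists q, im q = im p /\ size q = size (im p).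
Proof.
pose q := \poly_(i < size (im p)) p`_i.
have Eq : im q = im p.
  apply/polyP => i; rewrite !coef_map coef_poly; case: ltnP => // szi.
  by rewrite raddf0 -coef_map [RHS]nth_default.
exists q; split=> //; apply/eqP; rewrite eqn_leq size_poly /=.
by rewrite -Eq; apply: size_poly.
Qed.

Lemma size_im p : (size (im p) <= size p)%N.
Proof. exact: size_poly. Qed.

(* Atiyah-Macdonald 5.23 for [iota B <= (iota B)[x]], rings being given by
   evaluation maps; [r] is any root of [q] in an extension of [O]. *)
Lemma extend_step (v : {poly B}) : (im v).[x] != 0 ->
  exists u : B, iota u != 0 /\
  forall (O : fieldType) (phi : {rmorphism B -> O}),
    (forall b, iota b = 0 -> phi b = 0) -> phi u != 0 ->
  exists q : {poly O}, (1 < size q)%N /\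
  forall (O' : fieldType) (i : {rmorphism O -> O'}) r, root (map_poly i q) r ->
    (forall p, (im p).[x] = 0 -> (map_poly (i \o phi) p).[r] = 0) /\
    (map_poly (i \o phi) v).[r] != 0.
Proof.
move=> vx; have [[P0 P0P]|nalg] := pselect (exists P, im P != 0 /\ root (im P) x).
(* Algebraic case: [P] is a relation of least degree satisfied by [x]. *)
- have [P1 [[P1nz P1x] P1min]] := ex_minimal (fun q => size (im q))
    (ex_intro (fun P => im P != 0 /\ root (im P) x) P0 P0P).
  have [P [EP szP]] := trim_poly P1; rewrite -EP in szP P1nz P1x P1min.
  have Pmin (r : {poly B}) : (size r < size P)%N -> (im r).[x] = 0 -> im r = 0.
    move=> szr rx; apply/eqP/negPn/negP => rnz.
    have /= := P1min r (conj rnz (introT rootP rx)).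
    by rewrite EP -EP -szP leqNgt (leq_ltn_trans (size_im r) szr).
  have Pnz : P != 0 by apply: contraNneq P1nz => ->; rewrite /im rmorph0.
  have Pgt1 : (1 < size P)%N.
    by rewrite szP; apply: root_size_gt1 P1x.
  have lP : iota (lead_coef P) != 0.
    by rewrite lead_coefE szP -coef_map -lead_coefE lead_coef_eq0.
  (* Of the non-zero multiples of the value of [v], one of least degree turns out to be a constant
     [u0]; it plays the part of a norm. *)
  have [q1 [[q1x [w1 q1w]] q1min]] :
      exists q, ((im q).[x] != 0 /\ exists w, (im q).[x] = (im v).[x] * (im w).[x])
        /\ forall q', ((im q').[x] != 0 /\ exists w, (im q').[x] = (im v).[x] * (im w).[x])
           -> (size (im q) <= size (im q'))%N.
    apply: (ex_minimal (fun q => size (im q))); exists v; split=> //; exists 1.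
    by rewrite /im rmorph1 hornerC mulr1.
  have [q [Eq szq]] := trim_poly q1; rewrite -Eq in szq q1x q1w q1min.
  have qmin (r w : {poly B}) : (size r < size q)%N -> (im r).[x] = (im v).[x] * (im w).[x] ->
      (im r).[x] = 0.
    move=> szr rw; apply/eqP/negPn/negP => rnz.
    have := q1min r (conj rnz (ex_intro _ w rw)).
    by rewrite -szq leqNgt (leq_ltn_trans (size_im r) szr).
  have qnz : q != 0 by apply: contraNneq q1x => ->; rewrite /im rmorph0 horner0.
  have imq : im q != 0 by apply: contraNneq q1x => ->; rewrite horner0.
  have lq : iota (lead_coef q) != 0.
    by rewrite lead_coefE szq -coef_map -lead_coefE lead_coef_eq0.
  have imE (l : B) N (p s Q r : {poly B}) : l ^+ N *: p = s * Q + r ->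
      iota l ^+ N * (im p).[x] = (im s).[x] * (im Q).[x] + (im r).[x].
    move=> /(congr1 (fun p => (im p).[x])); rewrite /im rmorphD rmorphM /=.
    by rewrite map_polyZ /= !hornerE rmorphXn.
  have szqP : (size q < size P)%N.
    rewrite ltnNge; apply/negP => szPq.
    have [N [s [r [/imE E1 szr]]]] := pseudo_division q Pnz.
    rewrite (rootP P1x) mulr0 add0r q1w in E1.
    have E2 : (im r).[x] = (im v).[x] * (im ((lead_coef P ^+ N) *: w1)).[x].
      by rewrite /im map_polyZ hornerZ rmorphXn -E1 mulrCA.
    have /eqP := qmin _ _ (leq_trans szr szPq) E2.
    by rewrite -E1 -q1w mulf_eq0 expf_eq0 (negPf lP) (negPf q1x) andbF.
  (* Otherwise divide [P] by [q]: the remainder is a multiple of [v] at [x] of smaller degree, so it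
     vanishes, and the quotient is a relation of degree below that of [P]. *)
  have szq1 : size q = 1%N.
    apply/eqP; rewrite eqn_leq size_poly_gt0 qnz andbT leqNgt; apply/negP => szq2.
    have [N [s [r [E1 szr]]]] := pseudo_division P qnz.
    have E2 := imE _ _ _ _ _ _ E1; rewrite (rootP P1x) mulr0 in E2.
    have rx : (im r).[x] = 0.
      apply: (qmin _ (- s * w1)) => //.
      have {E2}-> : (im r).[x] = - ((im s).[x] * (im q).[x]).
        by apply/eqP; rewrite -addr_eq0 addrC -E2.
      by rewrite /im rmorphM rmorphN /= hornerM hornerN q1w mulNr mulrN [in RHS]mulrCA.
    have r0 := Pmin _ (ltn_trans szr szqP) rx.
    have sx : (im s).[x] = 0.
      by apply: (mulIf q1x); rewrite mul0r; move: E2; rewrite rx addr0.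
    have E3 : iota (lead_coef q) ^+ N *: im P = im s * im q.
      have := congr1 im E1; rewrite /im rmorphD rmorphM /= map_polyZ rmorphXn => ->.
      by rewrite -!/(im _) r0 addr0.
    have snz : im s != 0.
      apply: contraNneq P1nz => s0; move/eqP: E3.
      by rewrite s0 mul0r scaler_eq0 expf_eq0 (negPf lq) andbF EP.
    have := congr1 (fun p : {poly E} => size p) E3; rewrite size_scale ?expf_neq0 //.
    rewrite size_mul // -szP -szq => szE.
    have szs : (size (im s) < size P)%N.
      by rewrite szE -subn1 -addnBA ?(ltnW szq2) // -[X in (X < _)%N]addn0 ltn_add2l subn_gt0.
    have [s' [Es szs']] := trim_poly s.
    by move: (Pmin s'); rewrite Es szs' => /(_ szs sx) s0; rewrite s0 eqxx in snz.
  have [u0 Eu0] : exists c, q = c%:P by exists q`_0; apply: size1_polyC; rewrite szq1.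
  have u0nz : iota u0 != 0 by move: q1x; rewrite Eu0 /im map_polyC hornerC.
  (* Keeping [lead_coef P] non-zero lets division by [P] survive [phi]; keeping [u0], the value of
     [v * w1], keeps [v] non-zero. *)
  exists (lead_coef P * u0); rewrite rmorphM mulf_neq0 //; split=> // O phi ker.
  rewrite rmorphM mulf_eq0 negb_or => /andP[lphi uphi].
  exists (map_poly phi P); split.
    apply: (leq_trans Pgt1); rewrite leqNgt; apply/negP => szlt.
    move/negP: lphi; apply; rewrite lead_coefE -coef_map nth_default //.
    by rewrite -ltnS prednK // size_poly_gt0.
  move=> O' i r rt; have rtP : (map_poly (i \o phi) P).[r] = 0.
    by rewrite map_poly_comp; apply/rootP.
  have kill (p : {poly B}) : (im p).[x] = 0 -> (map_poly (i \o phi) p).[r] = 0.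
    move=> px; have [N [s [t [E1 szt]]]] := pseudo_division p Pnz.
    have := imE _ _ _ _ _ _ E1; rewrite px (rootP P1x) !mulr0 add0r => /esym tx.
    have t0 := Pmin _ szt tx.
    have phit : map_poly (i \o phi) t = 0.
      apply/polyP => j; rewrite coef_map /= ker ?rmorph0 ?coef0 //.
      by rewrite -coef_map -/(im t) t0 coef0.
    have := congr1 (fun p => (map_poly (i \o phi) p).[r]) E1.
    rewrite /= rmorphD rmorphM /= phit addr0 hornerM rtP mulr0 map_polyZ hornerZ.
    move/eqP; rewrite rmorphXn mulf_eq0 expf_eq0 /= fmorph_eq0 (negPf lphi) andbF /=.
    by move/eqP.
  split=> //; have := kill (v * w1 - u0%:P).
  rewrite /im !rmorphB !rmorphM /= !map_polyC /= !hornerE -/(im v) -/(im w1) -q1w.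
  rewrite Eu0 /im map_polyC hornerC subrr => /(_ erefl) /eqP.
  rewrite subr_eq0 => /eqP E1; apply: contraNneq uphi => v0.
  by move: E1; rewrite v0 mul0r => /esym/eqP; rewrite fmorph_eq0.
(* Transcendental case: a relation has all its coefficients killed by [iota]. A root of [v * 'X - 1]
   is inverse to the value of [v], which is thereby non-zero. *)
- have imv : im v != 0 by apply: contraNneq vx => ->; rewrite horner0.
  exists (v`_(size (im v)).-1); rewrite -coef_map -lead_coefE lead_coef_eq0.
  split=> // O phi ker phiu; exists (map_poly phi v * 'X - 1); split.
    have phiv : map_poly phi v != 0.
      apply: contraNneq phiu => v0.
      by rewrite -(coef_map phi) v0 coef0.
    by rewrite size_polyDl ?size_polyN ?size_poly1 size_mulX // ltnS size_poly_gt0.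
  move=> O' i r; rewrite rmorphB rmorphM /= map_polyX rmorph1 -map_poly_comp.
  rewrite rootE !hornerE subr_eq0 => /eqP vr; split; last first.
    by apply: contra_eq_neq vr => ->; rewrite mul0r eq_sym oner_eq0.
  move=> p px; have p0 : im p = 0.
    by apply/eqP/negPn/negP => pnz; apply: nalg; exists p; split=> //; apply/rootP.
  rewrite [map_poly _ p](_ : _ = 0) ?horner0 //; apply/polyP => j.
  by rewrite coef_map /= ker ?rmorph0 ?coef0 // -coef_map -/(im p) p0 coef0.
Qed.

End ExtensionStep.

(** Variables are nested so that adjoining the last one is an instance of [extend_step] over the
    ring of the others. *)
Fixpoint multipoly (d : nat) (R : comNzRingType) : comNzRingType :=
  if d is d'.+1 then {poly multipoly d' R} else R.

Fixpoint mp_eval (d : nat) (R S : comNzRingType) (f : {rmorphism R -> S})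
    (x : nat -> S) : {rmorphism multipoly d R -> S} :=
  if d is d'.+1 return {rmorphism multipoly d R -> S}
  then horner_eval (x d') \o map_poly (mp_eval d' f x) else f.

Lemma mp_evalS d (R S : comNzRingType) (f : {rmorphism R -> S}) x p :
  mp_eval d.+1 f x p = (map_poly (mp_eval d f x) p).[x d].
Proof. by []. Qed.

Lemma eq_mp_eval d (R S : comNzRingType) (f g : {rmorphism R -> S}) x y :
  f =1 g -> (forall j, (j < d)%N -> x j = y j) -> mp_eval d f x =1 mp_eval d g y.
Proof.
move=> fg; elim: d => [|d IH] xy p; first exact: fg.
rewrite !mp_evalS xy //; congr (_.[_]); apply: eq_map_poly; apply: IH => j jd.
exact: xy (ltnW _).
Qed.

Lemma mp_eval_comp d (R S T : comNzRingType) (f : {rmorphism R -> S})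
    (g : {rmorphism S -> T}) x : g \o mp_eval d f x =1 mp_eval d (g \o f) (g \o x).
Proof.
elim: d => [|d IH] p //.
rewrite [RHS]mp_evalS -[LHS]/(g (map_poly (mp_eval d f x) p).[x d]).
rewrite -horner_map -map_poly_comp; congr (_.[_]); exact: eq_map_poly.
Qed.

Fixpoint mp_const (d : nat) (R : comNzRingType) (c : R) : multipoly d R :=
  if d is d'.+1 return multipoly d R then (mp_const d' c)%:P else c.

Lemma mp_eval_const d (R S : comNzRingType) (f : {rmorphism R -> S}) x c :
  mp_eval d f x (mp_const d c) = f c.
Proof. by elim: d => //= d IH; rewrite /horner_eval map_polyC hornerC. Qed.

Fixpoint mp_var (d : nat) (R : comNzRingType) (i : nat) : multipoly d R :=
  if d is d'.+1 return multipoly d R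
  then (if i == d' then 'X else (mp_var d' R i)%:P) else 0.

Lemma mp_eval_var d (R S : comNzRingType) (f : {rmorphism R -> S}) x i :
  (i < d)%N -> mp_eval d f x (mp_var d R i) = x i.
Proof.
elim: d => // d IH; rewrite ltnS leq_eqVlt /=; have [->|_] /= := eqVneq i d.
  by rewrite /horner_eval map_polyX hornerX.
by move=> /IH idE; rewrite /horner_eval map_polyC hornerC.
Qed.

Definition has_roots (K : fieldType) : Prop :=
  forall q : {poly K}, (1 < size q)%N -> exists x, root q x.

Lemma irreducible_factor (K : fieldType) (q : {poly K}) : (1 < size q)%N ->
  exists s : {poly K}, irreducible_poly s /\ s %| q.
Proof.
move=> q1; have [s [[s1 sq] smin]] : exists s : {poly K}, ((1 < size s)%N /\ s %| q) /\
    forall t : {poly K}, ((1 < size t)%N /\ t %| q) -> (size s <= size t)%N.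
  by apply: (ex_minimal (fun s : {poly K} => size s)); exists q.
exists s; split=> //; split=> // t t1 ts.
rewrite -dvdp_size_eqp // eqn_leq dvdp_leq ?smin //=; last first.
  by rewrite -size_poly_gt0 ltnW.
split; last exact: dvdp_trans ts sq.
rewrite ltn_neqAle eq_sym t1 size_poly_gt0; apply: contraTneq ts => ->.
by rewrite dvd0p -size_poly_gt0 ltnW.
Qed.

Lemma adjoin_root (K : fieldType) (q : {poly K}) : (1 < size q)%N ->
  exists (L : fieldType) (i : {rmorphism K -> L}) x, root (map_poly i q) x.
Proof.
move=> /irreducible_factor[s [/irredp_FAdjoin[L _ [z sz _]] sq]].
exists L, (in_alg L), z; apply: root_dvdp sz.
by rewrite dvdp_map.
Qed.

Section Extension.
Variables (R : comNzRingType) (E : fieldType) (iota : {rmorphism R -> E}).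
Variables (x : nat -> E).

Definition specializes (O : fieldType) (phi : {rmorphism R -> O}) d
    (v : multipoly d R) (r : nat -> O) : Prop :=
  (forall p, mp_eval d iota x p = 0 -> mp_eval d phi r p = 0) /\
  mp_eval d phi r v != 0.

Lemma specializesS (O O1 : fieldType) (f : {rmorphism O -> O1})
    (phi : {rmorphism R -> O}) d (v : multipoly d.+1 R) (r : nat -> O) rd :
  (forall p : {poly multipoly d R}, (map_poly (mp_eval d iota x) p).[x d] = 0 ->
     (map_poly (f \o mp_eval d phi r) p).[rd] = 0) /\
  (map_poly (f \o mp_eval d phi r) v).[rd] != 0 ->
  specializes (f \o phi) v (fun j => if (j < d)%N then f (r j) else rd).
Proof.
have E1 p : mp_eval d.+1 (f \o phi) (fun j => if (j < d)%N then f (r j) else rd) p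
    = (map_poly (f \o mp_eval d phi r) p).[rd].
  rewrite mp_evalS ltnn; congr (_.[_]); apply: eq_map_poly => b.
  by rewrite mp_eval_comp; apply: eq_mp_eval => // j ->.
by move=> [h1 h2]; split=> [p px|]; rewrite E1 //; apply: h1.
Qed.

Lemma eq_specializes (O : fieldType) (phi psi : {rmorphism R -> O}) d
    (v : multipoly d R) (r : nat -> O) :
  phi =1 psi -> specializes phi v r -> specializes psi v r.
Proof.
move=> E1 [h1 h2]; split=> [p /h1|].
  by rewrite (eq_mp_eval (y := r) E1).
by rewrite -(eq_mp_eval (x := r) E1).
Qed.

(** What [extend_step] must keep non-zero for the last variable is a polynomial in the others, and
    becomes the [v] of the induction. The first conclusion, without field extension, serves the
    Nullstellensatz; the second serves specialization into a field that need not have roots. *)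
Lemma extend_mp d (v : multipoly d R) : mp_eval d iota x v != 0 ->
  exists u : R, iota u != 0 /\
  forall (O : fieldType) (phi : {rmorphism R -> O}),
    (forall b, iota b = 0 -> phi b = 0) -> phi u != 0 ->
  (has_roots O -> exists r, specializes phi v r) /\
  (exists (O' : fieldType) (i : {rmorphism O -> O'}) r,
     specializes (i \o phi) v r).
Proof.
elim: d v => [|d IH] v vx.
  exists v; split=> // O phi ker phiv; split.
    by move=> _; exists (fun=> 0).
  exists O, (idfun : {rmorphism O -> O}), (fun=> 0); by split.
have [u1 [u1x step]] := extend_step (iota := mp_eval d iota x) vx.
have [u [ux main]] := IH _ u1x; exists u; split=> // O phi ker phiu.
have [mainc [O' [i [r [ker1 r1]]]]] := main O phi ker phiu; split.
  move=> Oroots; have [r' [ker1' r1']] := mainc Oroots.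
  have [q [q1 good]] := step O (mp_eval d phi r') ker1' r1'.
  have [rd qrd] := Oroots q q1.
  have Qr : root (map_poly (idfun : {rmorphism O -> O}) q) rd.
    by rewrite map_poly_id.
  have := specializesS (good O (idfun : {rmorphism O -> O}) rd Qr).
  by move/eq_specializes => sp; eexists; apply: sp.
have [q [q1 good]] := step O' (mp_eval d (i \o phi) r) ker1 r1.
have [O1 [i1 [rd qrd]]] := adjoin_root q1.
have := specializesS (good O1 i1 rd qrd).
by move/eq_specializes => sp; exists O1, (i1 \o i); eexists; apply: sp.
Qed.

End Extension.

(** * Elements of tensor products as formal sums *)

(* The value at [(j, psi)] of the element of [K (x) A] represented by [h]. *)
Definition fev (K A : Type) (S : pzRingType) (j : K -> S) (psi : A -> S)
    (h : seq (K * A)) : S :=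
  \sum_(y <- h) j y.1 * psi y.2.

Section FormalSums.
Variables (K A S : comPzRingType) (j : {rmorphism K -> S}) (psi : {rmorphism A -> S}).
Implicit Types h : seq (K * A).
Local Notation ev := (fev j psi).

Definition fmul (h h' : seq (K * A)) : seq (K * A) :=
  [seq (y.1 * z.1, y.2 * z.2) | y <- h, z <- h'].
Definition fopp (h : seq (K * A)) : seq (K * A) := [seq (- y.1, y.2) | y <- h].
Definition fscale (c : K) (h : seq (K * A)) : seq (K * A) :=
  [seq (c * y.1, y.2) | y <- h].

Lemma fev_nil : ev [::] = 0.
Proof. by rewrite /fev big_nil. Qed.

Lemma fev_cons y h : ev (y :: h) = j y.1 * psi y.2 + ev h.
Proof. by rewrite /fev big_cons. Qed.

Lemma fev_cat h h' : ev (h ++ h') = ev h + ev h'.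
Proof. by rewrite /fev big_cat. Qed.

Lemma fev_opp h : ev (fopp h) = - ev h.
Proof.
rewrite /fev big_map -sumrN; apply: eq_bigr => y _.
by rewrite rmorphN mulNr.
Qed.

Lemma fev_mul h h' : ev (fmul h h') = ev h * ev h'.
Proof.
rewrite /fev big_allpairs_dep mulr_suml; apply: eq_bigr => y _.
by rewrite mulr_sumr; apply: eq_bigr => z _; rewrite !rmorphM mulrACA.
Qed.

Lemma fev_scale c h : ev (fscale c h) = j c * ev h.
Proof.
rewrite /fev big_map mulr_sumr; apply: eq_bigr => y _.
by rewrite rmorphM mulrA.
Qed.

Lemma fev_const c : ev [:: (c, 1)] = j c.
Proof. by rewrite fev_cons fev_nil rmorph1 mulr1 addr0. Qed.

Lemma fev_elt t : ev [:: (1, t)] = psi t.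
Proof. by rewrite fev_cons fev_nil rmorph1 mul1r addr0. Qed.

Lemma fev_one : ev [:: (1, 1)] = 1.
Proof. by rewrite fev_elt rmorph1. Qed.

Definition fexp h n := iter n (fmul h) [:: (1, 1)].

Lemma fev_exp h n : ev (fexp h n) = ev h ^+ n.
Proof.
elim: n => [|n IH]; first exact: fev_one.
by rewrite /fexp iterS -/(fexp h n) fev_mul IH exprS.
Qed.

End FormalSums.

Lemma eq_fev (K A : Type) (S : pzRingType) (j j' : K -> S) (psi psi' : A -> S) :
  j =1 j' -> psi =1 psi' -> fev j psi =1 fev j' psi'.
Proof. by move=> E1 E2 h; apply: eq_bigr => y _; rewrite E1 E2. Qed.

Lemma fev_comp (K A : Type) (S T : pzRingType) (l : {rmorphism S -> T})
    (j : K -> S) (psi : A -> S) h : l (fev j psi h) = fev (l \o j) (l \o psi) h.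
Proof. by rewrite /fev rmorph_sum; apply: eq_bigr => y _; rewrite rmorphM. Qed.

Lemma fev_map (K K' A : Type) (S : pzRingType) (g : K -> K') (j : K' -> S)
    (psi : A -> S) h : fev j psi [seq (g y.1, y.2) | y <- h] = fev (j \o g) psi h.
Proof. by rewrite /fev big_map. Qed.

(** * Points of finitely generated algebras *)

Section FinitelyGenerated.
Variables (k : fieldType) (A : alg k).

(** A substitute for a presentation of [A]: the polynomial for [t] is chosen before the point. The
    choice is not a homomorphism in [t], but becomes one after evaluation wherever the relations of
    [psi] hold. *)
Lemma fg_multipoly : finitely_generated A ->
  exists (n : nat) (s : nat -> A), forall (D : comNzRingType) (e : {rmorphism k -> D}) (t : A),
  exists p : multipoly n D, forall (O : fieldType) (rho : {rmorphism D -> O})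
    (psi : {rmorphism A -> O}), (forall c, psi (alg_str A c) = rho (e c)) ->
    psi t = mp_eval n rho (psi \o s) p.
Proof.
move=> [n [s gen]]; pose s' i := if insub i is Some j then s j else 0.
exists n, s' => D e; apply: gen.
- move=> c; exists (mp_const n (e c)) => O rho psi psiE.
  by rewrite mp_eval_const psiE.
- move=> i; exists (mp_var n D i) => O rho psi _.
  by rewrite mp_eval_var // /s' /= valK.
- move=> x y [p px] [q qy]; exists (p + q) => O rho psi psiE.
  by rewrite !rmorphD (px O rho) // (qy O rho).
- move=> x y [p px] [q qy]; exists (p * q) => O rho psi psiE.
  by rewrite !rmorphM (px O rho) // (qy O rho).
Qed.

Lemma fev_multipoly (s : nat -> A) (D : comNzRingType) d (p : multipoly d D) :
  exists h : seq (D * A), forall (O : fieldType) (rho : {rmorphism D -> O})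
    (psi : {rmorphism A -> O}), mp_eval d rho (psi \o s) p = fev rho psi h.
Proof.
elim: d p => [|d IH] p.
  by exists [:: (p, 1)] => O rho psi; rewrite fev_const.
elim/poly_ind: p => [|p c [h hp]].
  by exists [::] => O rho psi; rewrite rmorph0 fev_nil.
have [hc hcE] := IH c; exists (fmul h [:: (1, s d)] ++ hc) => O rho psi.
rewrite fev_cat fev_mul fev_elt -hp -hcE !mp_evalS rmorphD rmorphM /=.
by rewrite map_polyX map_polyC !hornerE.
Qed.

End FinitelyGenerated.

Section Nullstellensatz.
Variables (k : fieldType) (A : alg k) (A_fg : finitely_generated A).

(** This is [extend_mp] for the identity of [D]: as [j] is injective, coefficients satisfy no
    relation. All relations of [psi] are preserved at once, together with one inequation. *)
Lemma nullstellensatz (D O : fieldType) (e : {rmorphism k -> D})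
    (j : {rmorphism D -> O}) (psi : {rmorphism A -> O}) (w : seq (D * A)) :
  has_roots D -> (forall c, psi (alg_str A c) = j (e c)) -> fev j psi w != 0 ->
  exists chi : ahom A (Alg e),
    (forall h, fev j psi h = 0 -> fev idfun chi h = 0) /\ fev idfun chi w != 0.
Proof.
move=> Droots psiE; have [n [s rep]] := fg_multipoly A_fg.
have /choice[P PE] := rep D e.
pose Q (h : seq (D * A)) : multipoly n D := \sum_(y <- h) mp_const n y.1 * P y.2.
have QE (O1 : fieldType) (rho : {rmorphism D -> O1}) x h :
    mp_eval n rho x (Q h) = fev rho (mp_eval n rho x \o P) h.
  by rewrite rmorph_sum; apply: eq_bigr => y _; rewrite rmorphM mp_eval_const.
have QpsiE h : mp_eval n j (psi \o s) (Q h) = fev j psi h.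
  by rewrite QE; apply: eq_fev => // t /=; rewrite -PE.
rewrite -QpsiE => /extend_mp[u [ju main]].
have ker0 b : j b = 0 -> (idfun : {rmorphism D -> D}) b = 0.
  by move=> /eqP; rewrite fmorph_eq0 => /eqP.
have u_neq0 : (idfun : {rmorphism D -> D}) u != 0.
  by apply: contraNneq ju => /= ->; rewrite rmorph0.
have [r [ker rw]] := (main D _ ker0 u_neq0).1 Droots.
pose chi0 := mp_eval n (idfun : {rmorphism D -> D}) r \o P.
have chiE (x : multipoly n D) y : mp_eval n j (psi \o s) x = mp_eval n j (psi \o s) y ->
    mp_eval n (idfun : {rmorphism D -> D}) r x = mp_eval n (idfun : {rmorphism D -> D}) r y.
  move=> E; apply/eqP; rewrite -subr_eq0 -rmorphB; apply/eqP; apply: ker.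
  by rewrite rmorphB E subrr.
(* The defects of additivity and multiplicativity of [P] are relations satisfied by [psi], hence by
   [r]. *)
have chi_zmod : zmod_morphism chi0.
  by move=> x y; rewrite /chi0 /= -rmorphB; apply: chiE; rewrite rmorphB -!PE // rmorphB.
have chi_monoid : monoid_morphism chi0.
  split=> [|x y].
    by rewrite /chi0 /= -(rmorph1 (mp_eval n (idfun : {rmorphism D -> D}) r)); apply: chiE;
       rewrite -PE // !rmorph1.
  by rewrite /chi0 /= -rmorphM; apply: chiE; rewrite rmorphM -!PE // rmorphM.
pose chiZ := GRing.isZmodMorphism.Build A D chi0 chi_zmod.
pose chiM := GRing.isMonoidMorphism.Build A D chi0 chi_monoid.
pose chi : {rmorphism A -> D} := HB.pack chi0 chiZ chiM.
have chi_str c : chi (alg_str A c) = e c.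
  rewrite -[LHS]/(chi0 _) /chi0 /=.
  rewrite -[RHS](mp_eval_const n (idfun : {rmorphism D -> D}) r (e c)).
  by apply: chiE; rewrite -PE // mp_eval_const.
exists (@AHom k A (Alg e) chi chi_str); split=> [h|] /=.
  by rewrite -QpsiE => /ker; rewrite QE.
by move: rw; rewrite QE.
Qed.

(** The base ring is [{poly K}] with ['X] sent to [gamma], which is injective by transcendence. So
    ['X] may be sent to any [gamma0] outside the zeros of the [u] of [extend_mp], and identities
    [f = gamma * g] are relations over this ring. *)
Lemma specialize_transcendental (K E : fieldType) (e : {rmorphism k -> K})
    (j : {rmorphism K -> E}) (psi : {rmorphism A -> E}) (gamma : E) :
  (forall c, psi (alg_str A c) = j (e c)) ->
  (forall u : {poly K}, u != 0 -> (map_poly j u).[gamma] != 0) ->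
  exists u : {poly K}, u != 0 /\
  forall gamma0, u.[gamma0] != 0 -> forall (U : fieldType) (l : {rmorphism K -> U}),
  exists (O : fieldType) (i : {rmorphism U -> O}) (theta : {rmorphism A -> O}),
    (forall c, theta (alg_str A c) = i (l (e c))) /\
    forall f g : seq (K * A), fev j psi f = gamma * fev j psi g ->
      fev (i \o l) theta f = i (l gamma0) * fev (i \o l) theta g.
Proof.
move=> psiE trans; have [n [s rep]] := fg_multipoly A_fg.
pose iota : {rmorphism {poly K} -> E} := horner_eval gamma \o map_poly j.
have iotaC c : iota c%:P = j c by rewrite /iota /= /horner_eval map_polyC hornerC.
have iotaX : iota 'X = gamma by rewrite /iota /= /horner_eval map_polyX hornerX.
have /choice[P PE] := rep {poly K} (polyC \o e).
pose Q (h : seq (K * A)) : multipoly n {poly K} :=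
  \sum_(y <- h) mp_const n (y.1%:P) * P y.2.
have QE (O1 : fieldType) (rho : {rmorphism {poly K} -> O1}) x h :
    mp_eval n rho x (Q h) = fev (rho \o polyC) (mp_eval n rho x \o P) h.
  by rewrite rmorph_sum; apply: eq_bigr => y _; rewrite rmorphM mp_eval_const.
have PE' t : psi t = mp_eval n iota (psi \o s) (P t).
  by apply: PE => c; rewrite psiE [RHS]iotaC.
have QpsiE h : mp_eval n iota (psi \o s) (Q h) = fev j psi h.
  by rewrite QE; apply: eq_fev => t; [exact: iotaC | rewrite [RHS]PE'].
have one_neq0 : mp_eval n iota (psi \o s) 1 != 0 by rewrite rmorph1 oner_neq0.
have [u [ju main]] := extend_mp one_neq0; exists u; split.
  by apply: contraNneq ju => ->; rewrite rmorph0.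
move=> gamma0 u0 U l.
pose phi : {rmorphism {poly K} -> U} := horner_eval (l gamma0) \o map_poly l.
have phiC c : phi c%:P = l c by rewrite /phi /= /horner_eval map_polyC hornerC.
have phiX : phi 'X = l gamma0 by rewrite /phi /= /horner_eval map_polyX hornerX.
have ker0 b : iota b = 0 -> phi b = 0.
  move=> b0; suff -> : b = 0 by rewrite rmorph0.
  by apply/eqP/negPn/negP => /trans/eqP.
have u_neq0 : phi u != 0 by rewrite /phi /= /horner_eval horner_map fmorph_eq0.
have [O [i [r [ker _]]]] := (main U phi ker0 u_neq0).2.
pose chi0 := mp_eval n (i \o phi) r \o P.
have chiE x y : mp_eval n iota (psi \o s) x = mp_eval n iota (psi \o s) y ->
    mp_eval n (i \o phi) r x = mp_eval n (i \o phi) r y.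
  move=> E1; apply/eqP; rewrite -subr_eq0 -rmorphB; apply/eqP; apply: ker.
  by rewrite rmorphB E1 subrr.
have chi_zmod : zmod_morphism chi0.
  by move=> x y; rewrite /chi0 /= -rmorphB; apply: chiE; rewrite rmorphB -!PE' // rmorphB.
have chi_monoid : monoid_morphism chi0.
  split=> [|x y].
    by rewrite /chi0 /= -(rmorph1 (mp_eval n (i \o phi) r)); apply: chiE;
       rewrite -PE' // !rmorph1.
  by rewrite /chi0 /= -rmorphM; apply: chiE; rewrite rmorphM -!PE' // rmorphM.
pose chiZ := GRing.isZmodMorphism.Build A O chi0 chi_zmod.
pose chiM := GRing.isMonoidMorphism.Build A O chi0 chi_monoid.
pose chi : {rmorphism A -> O} := HB.pack chi0 chiZ chiM.
exists O, i, chi; split=> [c|f g fg].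
  transitivity ((i \o phi) (e c)%:P); last by congr (i _); apply: phiC.
  rewrite -(mp_eval_const n (i \o phi) r); apply: chiE.
  by rewrite -PE' mp_eval_const [RHS]iotaC.
have := ker (Q f - mp_const n 'X * Q g).
rewrite !rmorphB !rmorphM /= !mp_eval_const !QpsiE iotaX fg subrr => /(_ erefl)/eqP.
rewrite subr_eq0 => /eqP; rewrite !QE.
have chiE' h : fev ((i \o phi) \o polyC) (mp_eval n (i \o phi) r \o P) h
    = fev (i \o l) chi h by apply: eq_fev => // c; congr (i _); apply: phiC.
by rewrite !chiE' => ->; congr (_ * _); congr (i _); apply: phiX.
Qed.

End Nullstellensatz.

(** * Noetherian polynomial rings *)

Section Noetherian.
Variable R : comNzRingType.

Definition ideal (I : R -> Prop) : Prop :=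
  [/\ I 0, forall x y, I x -> I y -> I (x + y) & forall a x, I x -> I (a * x)].

Definition noetherian : Prop :=
  forall I : nat -> R -> Prop, (forall n, ideal (I n)) ->
    (forall n x, I n x -> I n.+1 x) ->
  exists N, forall n x, (N <= n)%N -> I n x -> I N x.

Lemma chain_mono (I : nat -> R -> Prop) : (forall n x, I n x -> I n.+1 x) ->
  forall m n x, (m <= n)%N -> I m x -> I n x.
Proof.
move=> S m n x /subnK <-; elim: (n - m)%N => // i IH Ix.
by rewrite addSn; apply: S; apply: IH.
Qed.

End Noetherian.

Lemma noetherian_field (K : fieldType) : noetherian K.
Proof.
move=> I idI mono; have [[n [x [Ix x0]]]|no] := pselect (exists n x, I n x /\ x <> 0).
  exists n => m y _ _; have [_ _ mul] := idI n.
  have -> : y = (y / x) * x by rewrite mulfVK //; apply/eqP.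
  exact: mul.
exists 0 => m y _ Iy; have [->|y0] := eqVneq y 0; first by have [] := idI 0.
by case: no; exists m, y; split=> //; apply/eqP.
Qed.

(** Hilbert's basis theorem: [L m j] is the ideal of degree-[m] coefficients of members of [I j] of
    degree at most [m], and it grows in both indices. *)
Lemma noetherian_poly (R : comNzRingType) : noetherian R -> noetherian {poly R}.
Proof.
move=> noethR I idI mono.
pose L m j c := exists p : {poly R}, [/\ I j p, (size p <= m.+1)%N & p`_m = c].
have idL m j : ideal (L m j).
  have [I0 ID IM] := idI j; split.
  - by exists 0; rewrite size_poly0 coef0.
  - move=> _ _ [p [Ip sp <-]] [q [Iq sq <-]]; exists (p + q).
    by rewrite coefD; split; [apply: ID| apply: leq_trans (size_polyD _ _) _; rewrite geq_max sp|].
  - move=> a _ [p [Ip sp <-]]; exists (a%:P * p); rewrite coefCM; split=> //.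
      exact: IM.
    by rewrite mul_polyC; apply: leq_trans (size_scale_leq _ _) _.
have LSj m j c : L m j c -> L m j.+1 c.
  by move=> [p [Ip sp pc]]; exists p; split=> //; apply: mono.
have LSm m j c : L m j c -> L m.+1 j c.
  move=> [p [Ip sp <-]]; have [_ _ IM] := idI j; exists ('X * p).
  rewrite coefXM /=; split=> //; first exact: IM.
  apply/leq_sizeP => -[//|i] ip; rewrite coefXM /=.
  by apply/(leq_sizeP _ _ sp).
have Lmono m j n l c : (m <= n)%N -> (j <= l)%N -> L m j c -> L n l c.
  move=> mn jl Lc; apply: (chain_mono (LSj n) jl).
  exact: (chain_mono (I := fun m => L m j) (fun m => LSm m j) mn Lc).
(* Stability of the diagonal from [N] on controls all rows from [N] on; the finitely many rows below
   are stabilized one by one. *)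
have [N Nst] : exists N, forall n c, (N <= n)%N -> L n n c -> L N N c.
  by apply: (noethR (fun n => L n n)) => // n c /LSj/LSm.
have [J [NJ Jst]] : exists J, (N <= J)%N /\
    forall m j c, (m < N)%N -> (J <= j)%N -> L m j c -> L m J c.
  elim: {2}N => [|N' [J [NJ Jst]]]; first by exists N.
  have [J' J'st] := noethR (L N') (idL N') (LSj N').
  exists (maxn J J'); split=> [|m j c]; first by rewrite leq_max NJ.
  rewrite ltnS geq_max leq_eqVlt => /orP[/eqP->|mN'] /andP[Jj J'j] Lc.
    by apply: Lmono (J'st _ _ J'j Lc) => //; rewrite leq_maxr.
  by apply: Lmono (Jst _ _ _ mN' Jj Lc) => //; rewrite leq_maxl.
have Lst m j c : (J <= j)%N -> L m j c -> L m J c.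
  move=> Jj; have [mN|Nm] := ltnP m N; first exact: Jst.
  move=> Lc; apply: (Lmono _ _ _ _ _ Nm NJ); apply: (Nst (maxn m j)).
    by rewrite leq_max Nm.
  by apply: Lmono Lc; rewrite ?leq_maxl ?leq_maxr.
exists J => j p Jj; have [m] := ubnP (size p).
elim: m p => // m IH p /ltnSE szp Ip; have [I0 ID IM] := idI J.
have [m0|m0] := posnP m.
  by move: szp; rewrite m0 leqn0 size_poly_eq0 => /eqP ->.
have [|q [Iq szq qE]] := Lst m.-1 j p`_m.-1 Jj.
  by exists p; rewrite prednK.
rewrite -(subrK q p); apply: ID => //; apply: IH.
  rewrite prednK // in szq.
  rewrite -(prednK m0) ltnS; apply/leq_sizeP => i; rewrite leq_eqVlt coefB.
  move=> /orP[/eqP<-|]; first by rewrite qE subrr.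
  rewrite prednK // => mi.
  by rewrite !nth_default ?subr0 //; [apply: leq_trans szq mi|apply: leq_trans szp mi].
have [_ ID' IM'] := idI j; apply: ID' => //.
rewrite -mulN1r; apply: IM'.
exact: (chain_mono mono Jj).
Qed.

Lemma noetherian_multipoly d (K : fieldType) : noetherian (multipoly d K).
Proof. by elim: d => [|d IH]; [exact: noetherian_field | exact: noetherian_poly]. Qed.

(** * Linear independence over the constants *)

(** Finitely many rows attain the maximal rank, and rank does not change from [K] to [O]; were it
    [q], the solution in [O] would be zero. *)
Lemma common_solution (K O : fieldType) (j : {rmorphism K -> O}) (q : nat)
    (a : nat -> 'I_q -> K) (v : 'I_q -> O) :
  (forall m, \sum_i j (a m i) * v i = 0) -> (exists i, v i != 0) ->
  exists w : 'I_q -> K, (exists i, w i != 0) /\ forall m, \sum_i a m i * w i = 0.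
Proof.
move=> av [i0 vi0].
pose M N := \matrix_(m < N, i < q) a m i.
have ex : exists r, `[< exists N, \rank (M N) = r >].
  by exists (\rank (M 0)); apply/asboolP; exists 0.
have ub r : `[< exists N, \rank (M N) = r >] -> (r <= q)%N.
  by move=> /asboolP[N <-]; apply: rank_leq_col.
case: (ex_maxnP ex ub) => r /asboolP[N rN] rmax.
have Mmono N' : (N <= N')%N -> (M N' <= M N)%MS.
  move=> NN'; have sub : (M N <= M N')%MS.
    apply/row_subP => m.
    have -> : row m (M N) = row (widen_ord NN' m) (M N').
      by apply/rowP => i; rewrite !mxE.
    exact: row_sub.
  rewrite -(geq_leqif (mxrank_leqif_sup sub)) rN.
  by apply: rmax; apply/asboolP; exists N'.
have [rq|rq] := leqP q r.
  have /row_fullP[B BM] : row_full (map_mx j (M N)).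
    by rewrite /row_full mxrank_map rN eqn_leq rq ub //; apply/asboolP; exists N.
  have v0 : map_mx j (M N) *m (\col_i v i) = 0.
    by apply/colP => m; rewrite !mxE -[RHS](av m); apply: eq_bigr => i _; rewrite !mxE.
  have := mulmxA B (map_mx j (M N)) (\col_i v i).
  rewrite v0 mulmx0 BM mul1mx => /colP/(_ i0); rewrite !mxE => /esym/eqP.
  by rewrite (negPf vi0).
have : kermx (M N)^T != 0.
  rewrite -mxrank_eq0 mxrank_ker mxrank_tr rN -lt0n subn_gt0 //.
case/rowV0Pn => w /sub_kermxP wM w0.
exists (w 0); split.
  apply: contrapT => no; move/negP: w0; apply; apply/eqP/rowP => i; rewrite !mxE.
  by apply/eqP/negPn/negP => wi; apply: no; exists i.
move=> m; have lt : (m < maxn N m.+1)%N by rewrite leq_max leqnn orbT.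
have : (row (Ordinal lt) (M (maxn N m.+1)) <= M N)%MS.
  by apply: submx_trans (row_sub _ _) (Mmono _ (leq_maxl _ _)).
case/submxP => u uE; have : row (Ordinal lt) (M (maxn N m.+1)) *m w^T = 0.
  by rewrite uE -mulmxA -[M N *m _]trmxK trmx_mul trmxK wM trmx0 mulmx0.
move/rowP/(_ 0); rewrite !mxE => E.
by rewrite -[RHS]E; apply: eq_bigr => i _; rewrite !mxE.
Qed.

Definition independent (K D : fieldType) (delta : {rmorphism D -> K}) q
    (nu : 'I_q -> K) : Prop :=
  forall c : 'I_q -> D, \sum_i delta (c i) * nu i = 0 -> forall i, c i = 0.

Section Constants.
Variables (K : idFieldType) (D : fieldType) (delta : {rmorphism D -> K}).

Definition constants_are : Prop :=
  forall x : K, (forall i, (0 < i)%N -> ider i x = 0) <-> exists c, x = delta c.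

Hypothesis delta_const : constants_are.

Lemma ider_const (c : D) i : (0 < i)%N -> ider i (delta c) = 0.
Proof. by move=> i0; apply: (delta_const _).2 i0; exists c. Qed.

Lemma iderMc (c : D) i (x : K) : ider i (delta c * x) = delta c * ider i x.
Proof.
rewrite iderM big_ord_recl ider0 subn0 big1 ?addr0 // => l _.
by rewrite ider_const ?mul0r.
Qed.

(** The solution descends to [K]. One of least support, normalized to have an entry [1], has
    derivatives that are solutions of smaller support, hence zero; so its entries are constants, and
    row [0] contradicts independence. *)
Lemma independent_ider q (nu : 'I_q -> K) (O : fieldType) (j : {rmorphism K -> O})
    (v : 'I_q -> O) :
  independent delta nu -> (forall m, \sum_i j (ider m (nu i)) * v i = 0) ->
  forall i, v i = 0.
Proof.
move=> indep sol i1; apply/eqP/negPn/negP => vi1.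
have [w0 [w0nz w0sol]] := common_solution sol (ex_intro _ i1 vi1).
pose supp (w : 'I_q -> K) := #|[pred i | w i != 0]|.
have [w1 [[w1nz w1sol] w1min]] := ex_minimal supp
  (ex_intro (fun w : 'I_q -> K => (exists i, w i != 0) /\
     forall m, \sum_i ider m (nu i) * w i = 0) w0 (conj w0nz w0sol)).
have [i0 w1i0] := w1nz; pose w i := w1 i / w1 i0.
have wi0 : w i0 = 1 by rewrite /w mulfV.
have wsol m : \sum_i ider m (nu i) * w i = 0.
  rewrite -[RHS](mul0r (w1 i0)^-1) -[in RHS](w1sol m) mulr_suml.
  by apply: eq_bigr => i _; rewrite mulrA.
(* Apply [ider n] to the relation of row [m]: the terms with [l > 0] are multiples of row [l + m]
   for [ider (n - l)], zero by induction, and [l = 0] remains. *)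
have dsol n : forall m, \sum_i ider m (nu i) * ider n (w i) = 0.
  elim/ltn_ind: n => n IH m.
  have : \sum_i \sum_(l < n.+1)
      ider l (ider m (nu i)) * ider (n - l)%N (w i) = 0.
    transitivity (ider n (\sum_i ider m (nu i) * w i)).
      by rewrite raddf_sum; apply: eq_bigr => i _; rewrite -iderM.
    by rewrite wsol raddf0.
  rewrite exchange_big big_ord_recl /= [X in _ + X]big1 ?addr0 => [|l _].
    by under eq_bigr => i _ do rewrite ider0 subn0.
  under eq_bigr => i _ do rewrite ider_comp mulrnAl.
  by rewrite sumrMnl IH ?mul0rn // /bump /= add1n subnS prednK ?leq_subr ?subn_gt0.
have wconst i n : (0 < n)%N -> ider n (w i) = 0.
  move=> n0; apply/eqP/negPn/negP => dw.
  have := w1min (fun i => ider n (w i)) (conj (ex_intro _ i dw) (dsol n)).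
  rewrite leqNgt => /negP; apply; apply: proper_card; apply/fintype.properP; split.
    apply/fintype.subsetP => l; rewrite !inE; apply: contraNneq => wl.
    by rewrite /w wl mul0r raddf0.
  by exists i0; rewrite !inE // wi0 ider1 // eqxx.
have /choice[c cE] : forall i, exists c, w i = delta c.
  by move=> i; apply/delta_const => n; apply: wconst.
have /indep/(_ i0) ci0 : \sum_i delta (c i) * nu i = 0.
  rewrite -[RHS](wsol 0); apply: eq_bigr => i _.
  by rewrite ider0 -cE mulrC.
by move/eqP: wi0; rewrite cE ci0 rmorph0 eq_sym oner_eq0.
Qed.

End Constants.

Section Reduction.
Variables (K D : fieldType) (delta : {rmorphism D -> K}) (A : Type).

Definition expands (h : seq (K * A)) q (nu : 'I_q -> K) (w : 'I_q -> seq (D * A)) :=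
  forall (S : comPzRingType) (g : K -> S) (l : {rmorphism D -> S}) (psi : A -> S),
    zmod_morphism g -> (forall c x, g (delta c * x) = l c * g x) ->
    fev g psi h = \sum_i g (nu i) * fev l psi (w i).

(** In an expansion of least length, a dependence among the [nu i] would let one of them be
    eliminated. *)
Lemma independent_expansion (h : seq (K * A)) :
  exists q (nu : 'I_q -> K) (w : 'I_q -> seq (D * A)),
    independent delta nu /\ expands h nu w.
Proof.
have [q [[nu [w hE]] qmin]] : exists q : nat,
    (exists (nu : 'I_q -> K) w, expands h nu w) /\
    forall q', (exists (nu : 'I_q' -> K) w, expands h nu w) -> (q <= q')%N.
  apply: (ex_minimal id); exists (size h), (fun i => (tnth (in_tuple h) i).1).
  exists (fun i => [:: (1, (tnth (in_tuple h) i).2)]) => S g l psi _ gl.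
  rewrite [LHS](big_tnth _ _ h); apply: eq_bigr => i _.
  by rewrite /fev big_seq1 mulrA [g _ * _]mulrC -gl rmorph1 mul1r.
exists q, nu, w; split=> // c cnu i0; apply/eqP/negPn/negP => ci0.
case: q => [|q] in nu w hE qmin c cnu i0 ci0 *; first by case: i0 ci0.
suff: (q < q)%N by rewrite ltnn.
apply: qmin.
pose b i := - (c (lift i0 i) / c i0).
exists (nu \o lift i0).
exists (fun i => w (lift i0 i) ++ [seq (b i * y.1, y.2) | y <- w i0]).
move=> S g l psi gZ gl; rewrite (hE S g l psi gZ gl) (bigD1_ord i0) //=.
have nuE : nu i0 = \sum_i delta (b i) * nu (lift i0 i).
  have dc : delta (c i0) != 0 by rewrite fmorph_eq0.
  apply: (mulfI dc); move/eqP: cnu; rewrite (bigD1_ord i0) //= addr_eq0 => /eqP ->.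
  rewrite mulr_sumr -sumrN; apply: eq_bigr => i _.
  by rewrite mulrA -rmorphM /b mulrN mulrCA mulfV // mulr1 rmorphN mulNr.
have gD : {morph g : x y / x + y >-> x + y}.
  have gN x : g (- x) = - g x.
    by rewrite -[- x]sub0r gZ -(subrr x) gZ subrr sub0r.
  by move=> x y; rewrite -[y in LHS]opprK gZ gN opprK.
have g0 : g 0 = 0 by rewrite -(subrr 0) gZ subrr.
rewrite nuE (big_morph g gD g0) mulr_suml -big_split; apply: eq_bigr => i _ /=.
rewrite gl /fev big_cat /= mulrDr addrC; congr (_ + _).
rewrite big_map mulr_sumr mulr_sumr; apply: eq_bigr => y _ /=.
by rewrite rmorphM !mulrA [g _ * _]mulrC.
Qed.

End Reduction.

Local Open Scope classical_set_scope.

(** * Rings of regular functions *)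

Lemma rmorphism_ext (R S : pzSemiRingType) (f g : {rmorphism R -> S}) :
  f =1 g -> f = g.
Proof.
case: f => f cf; case: g => g cg /= /funext fg; rewrite -{}fg in cg *; congr GRing.RMorphism.Pack.
case: cf => [[f1] [f2]]; case: cg => [[g1] [g2]].
by rewrite (Prop_irrelevance f1 g1) (Prop_irrelevance f2 g2).
Qed.

Lemma ahom_ext (k : fieldType) (A B : alg k) (f g : ahom A B) : f =1 g -> f = g.
Proof.
case: f => f sf; case: g => g sg /= /rmorphism_ext fg.
by rewrite -{}fg in sg *; rewrite (Prop_irrelevance sf sg).
Qed.

Lemma fmapE (k : fieldType) (X : functor k) (A B C : alg k) (g : ahom B C)
    (f : ahom A B) (h : ahom A C) (x : X A) :
  (forall a, g (f a) = h a) -> fmap g (fmap f x) = fmap h x.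
Proof. by move=> E; rewrite -fmap_comp; congr (fmap _ x); apply: ahom_ext. Qed.

Lemma gmapE (k : fieldType) (G : group_functor k) (A B C : alg k) (g : ahom B C)
    (f : ahom A B) (h : ahom A C) (x : gobj G A) :
  (forall a, g (f a) = h a) -> gmap g (gmap f x) = gmap h x.
Proof. exact: (@fmapE k (points G)). Qed.

Section Regular.
Variables (k K O : fieldType) (e : {rmorphism k -> K}) (j : {rmorphism K -> O}).
Variables (rho : {rmorphism k -> O}) (rhoE : forall c, j (e c) = rho c).
Variables (A : alg k) (T : Type) (pts : T -> ahom A (Alg rho)).
Variable i0 : seq (K * A).

Local Notation ev t := (fev j (pts t)).

(** Stands for [K (x) A] localized at [i0], as functions on [T]: the family [pts] becomes a single
    point over this algebra. It serves with [i0 = 1], or with [T] restricted to where [i0] does not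
    vanish. *)
Definition regular : {pred T -> O} :=
  fun f => `[< exists n h, forall t, f t * ev t i0 ^+ n = ev t h >].

Fact regular_subring : subring_closed regular.
Proof.
split.
- by apply/asboolP; exists 0, [:: (1, 1)] => t; rewrite fev_one mulr1.
- move=> f g /asboolP[n [h fh]] /asboolP[m [h' gh']]; apply/asboolP.
  exists (n + m)%N, (fmul h (fexp i0 m) ++ fopp (fmul h' (fexp i0 n))) => t.
  rewrite fev_cat fev_opp !fev_mul !fev_exp -fh -gh' exprD.
  rewrite -[(f - g) t]/(f t - g t) mulrBl mulrA; congr (_ - _).
  by rewrite -!mulrA [X in _ * X]mulrC.
- move=> f g /asboolP[n [h fh]] /asboolP[m [h' gh']]; apply/asboolP.
  exists (n + m)%N, (fmul h h') => t.
  by rewrite fev_mul -fh -gh' exprD mulrACA.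
Qed.

HB.instance Definition _ := GRing.isSubringClosed.Build (T -> O) regular regular_subring.

Definition regularType := sig (fun f : T -> O => f \in regular).
HB.instance Definition _ := SubChoice.on regularType.
HB.instance Definition _ := GRing.SubChoice_isSubComPzRing.Build (T -> O) _ regularType regular_subring.

Lemma regularP (f : regularType) :
  exists n h, forall t, val f t * ev t i0 ^+ n = ev t h.
Proof. by have /asboolP := valP f. Qed.

Fact regular_fev h : (fun t => ev t h) \in regular.
Proof. by apply/asboolP; exists 0, h => t; rewrite mulr1. Qed.

Definition reg_of h : regularType := Sub (fun t => ev t h) (regular_fev h).

Definition reg_const (c : K) := reg_of [:: (c, 1)].
Definition reg_elt (a : A) := reg_of [:: (1, a)].

Lemma reg_constE c t : val (reg_const c) t = j c.
Proof. exact: fev_const. Qed.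

Lemma reg_eltE a t : val (reg_elt a) t = pts t a.
Proof. exact: fev_elt. Qed.

Lemma reg_ext (f g : regularType) : val f =1 val g -> f = g.
Proof. by move=> fg; apply: val_inj; apply: funext. Qed.

Fact reg_const_zmod : zmod_morphism reg_const.
Proof.
move=> x y; apply: reg_ext => t; rewrite rmorphB.
by rewrite reg_constE rmorphB -(reg_constE x t) -(reg_constE y t).
Qed.

Fact reg_const_monoid : monoid_morphism reg_const.
Proof.
split=> [|x y]; apply: reg_ext => t; rewrite reg_constE ?rmorph1 //.
by rewrite rmorphM [RHS]/(val (reg_const x) t * val (reg_const y) t) !reg_constE.
Qed.

HB.instance Definition _ := GRing.isZmodMorphism.Build K regularType reg_const reg_const_zmod.
HB.instance Definition _ := GRing.isMonoidMorphism.Build K regularType reg_const reg_const_monoid.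

Fact reg_elt_zmod : zmod_morphism reg_elt.
Proof.
move=> x y; apply: reg_ext => t; rewrite rmorphB.
by rewrite reg_eltE rmorphB -(reg_eltE x t) -(reg_eltE y t).
Qed.

Fact reg_elt_monoid : monoid_morphism reg_elt.
Proof.
split=> [|x y]; apply: reg_ext => t; rewrite reg_eltE ?rmorph1 //.
by rewrite rmorphM [RHS]/(val (reg_elt x) t * val (reg_elt y) t) !reg_eltE.
Qed.

HB.instance Definition _ := GRing.isZmodMorphism.Build A regularType reg_elt reg_elt_zmod.
HB.instance Definition _ := GRing.isMonoidMorphism.Build A regularType reg_elt reg_elt_monoid.

Definition reg_ev (t : T) (f : regularType) : O := val f t.

Fact reg_ev_zmod t : zmod_morphism (reg_ev t).
Proof. by move=> x y; rewrite /reg_ev rmorphB. Qed.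

Fact reg_ev_monoid t : monoid_morphism (reg_ev t).
Proof. by split=> [|x y]; rewrite /reg_ev ?rmorph1 ?rmorphM. Qed.

HB.instance Definition _ t := GRing.isZmodMorphism.Build regularType O (reg_ev t) (reg_ev_zmod t).
HB.instance Definition _ t := GRing.isMonoidMorphism.Build regularType O (reg_ev t) (reg_ev_monoid t).

Definition reg_alg : alg k := @Alg k regularType (reg_const \o e).

Definition regK : ahom (Alg e) reg_alg := @AHom k (Alg e) reg_alg reg_const (fun _ => erefl).

Fact reg_elt_str c : reg_elt (alg_str A c) = alg_str reg_alg c.
Proof.
by apply: reg_ext => t; rewrite reg_eltE ahom_str [RHS]reg_constE rhoE.
Qed.

Definition regA : ahom A reg_alg := @AHom k A reg_alg reg_elt reg_elt_str.

Fact reg_ev_str t c : reg_ev t (alg_str reg_alg c) = alg_str (Alg rho) c.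
Proof. by rewrite -[RHS]rhoE; apply: reg_constE. Qed.

Definition regEv t : ahom reg_alg (Alg rho) :=
  @AHom k reg_alg (Alg rho) (reg_ev t) (reg_ev_str t).

End Regular.

Definition field_hom (k K O : fieldType) (e : {rmorphism k -> K})
    (j : {rmorphism K -> O}) (rho : {rmorphism k -> O})
    (rhoE : forall c, j (e c) = rho c) : ahom (Alg e) (Alg rho) :=
  @AHom k (Alg e) (Alg rho) j rhoE.

Lemma unit_ideal_field (k : fieldType) (K : fieldType) (e : {rmorphism k -> K})
    (I : set (Alg e)) :
  generates_unit_ideal I <-> exists x : K, I x /\ x != 0.
Proof.
split=> [[n [s [c [Is sc]]]]|[x [Ix x0]]].
  apply: contrapT => no; have /eqP := oner_neq0 K; case.
  rewrite -[LHS]sc big1 // => i _; suff -> : s i = 0 by rewrite mulr0.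
  by apply: contrapT => /eqP si; apply: no; exists (s i).
exists 1, (fun=> x), (fun=> x^-1); split=> //.
by rewrite big_ord1 [LHS]mulVf.
Qed.

(* Translating a point of an affine chart into another one is, near [t0], given
   by fractions with a common denominator. *)
Lemma local_translate (k K O : fieldType) (G : group_functor k)
    (e : {rmorphism k -> K}) (j : {rmorphism K -> O}) (rho : {rmorphism k -> O})
    (rhoE : forall c, j (e c) = rho c) (A' : alg k) (T : Type)
    (pts : T -> ahom A' (Alg rho)) (u' : gobj G A') (a0 : gobj G (Alg e))
    (A : alg k) (u : points G A) (t0 : T) (phi0 : ahom A (Alg rho)) :
  affine_open u ->
  gmap phi0 u = (gmap (field_hom rhoE) a0 * gmap (pts t0) u')%g ->
  exists (i : seq (K * A')) (N : A -> nat) (H : A -> seq (K * A')),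
    fev j (pts t0) i != 0 /\
    forall t, fev j (pts t) i != 0 -> exists Phi : ahom A (Alg rho),
      gmap Phi u = (gmap (field_hom rhoE) a0 * gmap (pts t) u')%g /\
      forall x, Phi x * fev j (pts t) i ^+ N x = fev j (pts t) (H x).
Proof.
move=> [_ u_open] phi0E.
pose one1 : seq (K * A') := [:: (1, 1)].
(* All translated points at once, as one point of [G] over the functions on [T]. *)
pose y := (gmap (regK e j pts one1) a0 * gmap (regA rhoE pts one1) u')%g.
have yE t : gmap (regEv rhoE pts _ t) y = (gmap (field_hom rhoE) a0 * gmap (pts t) u')%g.
  rewrite /y gmapM; congr (_ * _)%g; apply: gmapE => c.
    exact: reg_constE.
  exact: reg_eltE.
have [I IP] := u_open _ y.
have /unit_ideal_field[_ [[f If <-] ft0]] :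
    generates_unit_ideal ([eta regEv rhoE pts one1 t0] @` I).
  by apply/IP; exists phi0 => //; exact: etrans phi0E (esym (yE t0)).
have [n [i iE]] := regularP f.
have {}iE t : reg_ev t f = fev j (pts t) i.
  by rewrite -iE fev_one expr1n mulr1.
(* Where [f] does not vanish it is invertible, so over these points, [t0] among them, the whole
   family factors through the chart. *)
pose T1 := {t | fev j (pts t) i != 0}.
pose pts1 (t : T1) := pts (sval t).
pose res0 (g : regularType j pts one1) : T1 -> O := fun t => val g (sval t).
have res_reg g : res0 g \in regular j pts1 i.
  have [m [h hE]] := regularP g; apply/asboolP; exists 0, h => t.
  by rewrite mulr1 -hE fev_one expr1n mulr1.
pose res g : regularType j pts1 i := Sub (res0 g) (res_reg g).
have res_zmod : zmod_morphism res.
  move=> x z; apply: reg_ext => t; rewrite rmorphB.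
  by rewrite -[LHS]/(val (x - z) (sval t)) rmorphB.
have res_monoid : monoid_morphism res.
  by split=> [|x z]; apply: reg_ext => t; rewrite ?rmorph1 ?rmorphM.
pose resZ := GRing.isZmodMorphism.Build _ _ res res_zmod.
pose resM := GRing.isMonoidMorphism.Build _ _ res res_monoid.
pose resR : {rmorphism regularType j pts one1 -> regularType j pts1 i} :=
  HB.pack res resZ resM.
have res_str c : resR (alg_str (reg_alg e j pts one1) c) = alg_str (reg_alg e j pts1 i) c.
  by apply: reg_ext => t; rewrite [LHS]reg_constE [RHS]reg_constE.
pose restr := @AHom k (reg_alg e j pts one1) (reg_alg e j pts1 i) resR res_str.
pose inv0 (t : T1) : O := (fev j (pts1 t) i)^-1.
have inv_reg : inv0 \in regular j pts1 i.
  apply/asboolP; exists 1, one1 => t.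
  by rewrite fev_one expr1 mulVf // (svalP t).
have [phi _ phiE] : range (fun phi : ahom A (reg_alg e j pts1 i) => fmap phi u) (gmap restr y).
  apply/IP; exists 1, (fun=> restr f), (fun=> (Sub inv0 inv_reg : regularType j pts1 i)); split.
    by move=> _; exists f.
  rewrite big_ord1; apply: reg_ext => t.
  rewrite -[LHS]/((fev j (pts1 t) i)^-1 * reg_ev (sval t) f) iE mulVf //.
  exact: (svalP t).
have /choice[N /choice[H NH]] : forall x, exists n, exists h, forall t : T1,
    val (phi x) t * fev j (pts1 t) i ^+ n = fev j (pts1 t) h.
  by move=> x; apply: regularP.
exists i, N, H; split; first by rewrite -iE.
move=> t ti; pose t1 : T1 := exist _ t ti.
exists (ahom_comp (regEv rhoE pts1 i t1) phi); split; last by move=> x; apply: (NH x t1).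
rewrite gmap_comp [gmap phi u]phiE -yE; apply: gmapE => c.
by [].
Qed.

(** Over a field, openness only asks whether a set of scalars has a non-zero element, and this does
    not change from [K] to [O]. *)
Lemma affine_open_descent (k K O : fieldType) (X : functor k)
    (e : {rmorphism k -> K}) (j : {rmorphism K -> O}) (rho : {rmorphism k -> O})
    (rhoE : forall c, j (e c) = rho c) (A : alg k) (u : X A)
    (x : X (Alg e)) (phi : ahom A (Alg rho)) :
  affine_open u -> fmap phi u = fmap (field_hom rhoE) x ->
  exists phi0 : ahom A (Alg e), fmap phi0 u = x.
Proof.
move=> [_ u_open] phiE; have [I IP] := u_open _ x.
have /unit_ideal_field[_ [[f If <-] fnz]] :
    generates_unit_ideal ([eta field_hom rhoE] @` I).
  by apply/IP; exists phi.
have [phi0 _ phi0E] : range (fun phi : ahom A (Alg e) => fmap phi u)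
    (fmap (ahom_id (Alg e)) x).
  apply/IP/unit_ideal_field; exists f; split; first by exists f.
  by apply: contraNneq fnz => ->; rewrite rmorph0.
by exists phi0; rewrite phi0E fmap_id.
Qed.

(** * Power series and the uniform derivative *)

Section FpsInverse.
Variable R : comPzRingType.
Implicit Types f g : fps R.

Lemma fps_coefD f g n : coef (f + g) n = coef f n + coef g n.
Proof. by []. Qed.

Lemma fps_coefM f g n : coef (f * g) n = \sum_(i < n.+1) coef f i * coef g (n - i)%N.
Proof. by []. Qed.

Lemma coef_fps_sum (I : Type) (r : seq I) (P : pred I) (E : I -> fps R) n :
  coef (\sum_(i <- r | P i) E i) n = \sum_(i <- r | P i) coef (E i) n.
Proof.
by apply: (big_morph (fun f : fps R => coef f n)) => //; case: n.
Qed.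

Lemma coef_exp_small f m n : coef f 0 = 0 -> (m < n)%N -> coef (f ^+ n) m = 0.
Proof.
move=> f0; elim: n m => // n IH m mn; rewrite exprS fps_coefM big1 // => -[[|i] /= im] _.
  by rewrite f0 mul0r.
rewrite IH ?mulr0 //; rewrite ltnS in mn.
by apply: leq_trans mn; rewrite ltn_subrL /=; apply: (@leq_ltn_trans i).
Qed.

(** Geometric series in [1 - f], whose powers beyond the [n]-th do not reach coefficient [n]. *)
Lemma fps_invertible f : coef f 0 = 1 -> exists g, g * f = 1.
Proof.
move=> f0; pose E := 1 - f; have E0 : coef E 0 = 0 by rewrite -[LHS]/(1 - coef f 0) f0 subrr.
exists (Fps (fun n => \sum_(j < n.+1) coef (E ^+ j) n)); apply: fpsP => n.
transitivity (coef ((\sum_(j < n.+1) E ^+ j) * f) n).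
  rewrite !fps_coefM; apply: eq_bigr => i _; congr (_ * _).
  rewrite coef_fps_sum /= -!(big_mkord predT (fun j => coef (E ^+ j) i)).
  rewrite [RHS](big_cat_nat (n := i.+1)) //=.
  rewrite [X in _ = _ + X]big_nat_cond [X in _ = _ + X]big1 ?addr0 // => j.
  by move=> /andP[/andP[ij _] _]; apply: coef_exp_small.
have -> : f = 1 - E by rewrite /E opprB addrC subrK.
have -> : (\sum_(j < n.+1) E ^+ j) * (1 - E) = 1 - E ^+ n.+1.
  by rewrite -opprB mulrN mulrC -subrX1 opprB.
by rewrite fps_coefD -[coef (- _) n]/(- coef (E ^+ n.+1) n) coef_exp_small // subr0.
Qed.

End FpsInverse.

Lemma gmap1 (k : fieldType) (G : group_functor k) (A B : alg k) (f : ahom A B) :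
  gmap f (1 : gobj G A)%g = 1%g.
Proof.
apply: (@mulgI _ (gmap f (1 : gobj G A)%g)).
by rewrite -gmapM !mulg1.
Qed.

Section UniformDerivative.
Variables (U : idFieldType) (F : idSubfield U).
Local Notation k := (subfieldType (constantField F)).
Local Notation FT := (subfieldType F).
Variable G : algebraic_group k.

Lemma arc_pi_nabla (g : gobj G (univ_alg F)) : arc_pi (nabla g) = g.
Proof.
rewrite /arc_pi /nabla (@gmapE _ _ _ _ _ _ _ (ahom_id (univ_alg F))) ?gmap_id //.
by move=> a; apply: ider0.
Qed.

Variables (alpha : arc_bundle G (base_alg F)) (alpha_e : arc_e alpha).

(** A solution [a] satisfies [nabla a = alpha * s a], and the right-hand side makes sense for the
    family [x] of all solutions in the chart. This arc [y] reduces to [x], so it stays in the chart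
    and is a homomorphism from [A] to power series, whose coefficients are the required sums. *)
Lemma uniform_derivative (A : alg k) (u : points G A) : affine_open u ->
  exists d : nat -> A -> seq (FT * A),
  forall phi : ahom A (univ_alg F), solves alpha (gmap phi u) ->
  forall m t, ider m (phi t) = fev val phi (d m t).
Proof.
move=> [u_inj u_open].
pose T := {phi : ahom A (univ_alg F) | solves alpha (gmap phi u)}.
pose pts (t : T) : ahom A (univ_alg F) := sval t.
pose one1 : seq (FT * A) := [:: (1, 1)].
pose e : {rmorphism k -> FT} := sub_incl (@constants_sub U F).
pose j : {rmorphism FT -> U} := val.
have rhoE c : j (e c) = (val : {rmorphism k -> U}) c by [].
pose R := reg_alg e j pts one1.
pose x : gobj G R := gmap (regA rhoE pts one1) u.
pose beta : gobj G (arc_alg R) := gmap (arc_map (regK e j pts one1)) alpha.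
pose y : gobj G (arc_alg R) := (beta * gmap (arc_incl R) x)%g.
have yx : gmap (arc_red R) y = x.
  rewrite /y gmapM /beta.
  rewrite (@gmapE _ _ _ _ _ (arc_red R) (arc_incl R) (ahom_id R)) // gmap_id.
  have -> : gmap (arc_red R) (gmap (arc_map (regK e j pts one1)) alpha) =
      gmap (regK e j pts one1) (arc_pi alpha).
    by rewrite /arc_pi -!gmap_comp; congr (gmap _ _); apply: ahom_ext.
  by rewrite alpha_e gmap1 mul1g.
have [I IP] := u_open _ y.
have : generates_unit_ideal ([eta arc_red R] @` I).
  by apply/IP; exists (regA rhoE pts one1) => //; apply: esym yx.
case=> n [s [c [Is sc]]].
have /choice[f fE] i : exists f, I f /\ arc_red R f = s i.
  by have [f If fi] := Is i; exists f.
have [phi _ phiE] : range (fun phi : ahom A (arc_alg R) => fmap phi u)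
    (@fmap k (points G) _ _ (ahom_id (arc_alg R)) y).
  (* A combination that is [1] modulo [epsilon] is an invertible series, so [I] already generates
     the unit ideal over the arcs. *)
  have cE : coef (\sum_(i < n) fps_const (c i) * f i) 0 = 1.
    rewrite -[LHS]/(arc_red R _) rmorph_sum -sc; apply: eq_bigr => i _.
    by rewrite rmorphM; congr (_ * _); have [] := fE i.
  have [g gE] := fps_invertible cE.
  apply/IP; exists n, f, (fun i => g * fps_const (c i)); split.
    by move=> i; exists (f i); have [] := fE i.
  by rewrite -gE mulr_sumr; apply: eq_bigr => i _; rewrite mulrA.
have /choice[d dE] : forall mt : nat * A, exists h : seq (FT * A), forall p : T,
    reg_ev p (coef (phi mt.2) mt.1) = fev j (pts p) h.
  move=> [m t]; have [l [h hE]] := regularP (coef (phi t) m); exists h => p.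
  by rewrite -hE fev_one expr1n mulr1.
exists (fun m t => d (m, t)) => phi1 sol m t; pose p : T := exist _ phi1 sol.
rewrite -[fev _ _ _](dE (m, t) p) /=.
have E : gmap (ahom_comp (arc_map (regEv rhoE pts one1 p)) phi) u =
    gmap (ahom_comp (expD_hom F) phi1) u.
  rewrite !gmap_comp [gmap phi u]phiE [fmap _ _]gmap_id /y gmapM.
  have -> : gmap (arc_map (regEv rhoE pts one1 p)) beta = arc_base_incl alpha.
    apply: gmapE => a; apply: fpsP => i; exact: reg_constE.
  rewrite -sol /logD /arc_h arc_pi_nabla.
  suff -> : gmap (arc_map (regEv rhoE pts one1 p)) (gmap (arc_incl R) x) =
      arc_s (gmap phi1 u) by rewrite mulgVK.
  rewrite /arc_s /x -!gmap_comp; congr (gmap _ _); apply: ahom_ext => a.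
  by apply: fpsP => -[|i] //=; rewrite /reg_ev ?rmorph0 //; apply: reg_eltE.
by have /(_ t) /(congr1 (fun h : fps U => coef h m)) := u_inj _ _ _ E.
Qed.

(* The action of [ider m] on [F (x) A], given that on [A]. *)
Definition dform (A : Type) (d : nat -> A -> seq (FT * A)) (m : nat)
    (h : seq (FT * A)) : seq (FT * A) :=
  flatten [seq [seq (ider (l : 'I_m.+1) y.1 * z.1, z.2) | z <- d (m - l)%N y.2]
          | y <- h, l <- enum 'I_m.+1].

Lemma dformE (A : Type) (d : nat -> A -> seq (FT * A)) (phi : A -> U) :
  (forall m t, ider m (phi t) = fev val phi (d m t)) ->
  forall m h, ider m (fev val phi h) = fev val phi (dform d m h).
Proof.
move=> dE m h; rewrite /fev raddf_sum big_flatten big_allpairs_dep /=.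
apply: eq_bigr => y _; rewrite iderM big_enum /=; apply: eq_bigr => l _.
rewrite dE /fev big_map mulr_sumr; apply: eq_bigr => z _ /=.
by rewrite mulrA.
Qed.

End UniformDerivative.

(** * Constants of a model of SCH *)

Fact fps_oner_neq0 (R : comNzRingType) : (1 : fps R) != 0.
Proof.
by apply/eqP => /(congr1 (fun f : fps R => coef f 0)) /eqP; rewrite /= oner_eq0.
Qed.
HB.instance Definition _ (R : comNzRingType) :=
  GRing.PzSemiRing_isNonZero.Build (fps R) (@fps_oner_neq0 R).

Section FpsFrobenius.
Variables (R : comNzRingType) (p : nat) (R_char : p \in [pchar R]).
Implicit Types f g : fps R.

Lemma fps_pchar : p \in [pchar (fps R)].
Proof.
rewrite inE (pcharf_prime R_char) /=; apply/eqP.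
by rewrite -(rmorph_nat (@fps_const R)) (pcharf0 R_char) rmorph0.
Qed.

Definition fps_X : fps R := Fps (fun n => (n == 1)%:R).

Lemma coef_fpsXM f n : coef (fps_X * f) n = if n is m.+1 then coef f m else 0.
Proof.
rewrite fps_coefM; case: n => [|n]; first by rewrite big_ord1 mul0r.
rewrite (bigD1 (inord 1)) //= inordK // mul1r subSS subn0 big1 ?addr0 // => i.
move=> /eqP i1; have -> : (i == 1 :> nat) = false.
  by apply/eqP => E; apply: i1; apply: val_inj; rewrite /= inordK.
by rewrite mul0r.
Qed.

Lemma coef_fpsXnM f q n : coef (fps_X ^+ q * f) n = if (n < q)%N then 0 else coef f (n - q)%N.
Proof.
elim: q n => [|q IH] n; first by rewrite expr0 mul1r subn0.
by rewrite exprS -mulrA coef_fpsXM; case: n => // n; rewrite IH.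
Qed.

Lemma fps_split f : f = fps_const (coef f 0) + fps_X * Fps (fun n => coef f n.+1).
Proof.
by apply: fpsP => -[|n]; rewrite fps_coefD coef_fpsXM ?addr0 ?add0r.
Qed.

(** Additivity of Frobenius covers finite sums only, so the constant coefficient is split off and
    the induction goes on with the shifted series. *)
Lemma coef_fps_frobenius f m n : let q := (p ^ m)%N in
  coef (f ^+ q) n = if (q %| n)%N then coef f (n %/ q)%N ^+ q else 0.
Proof.
move=> q; have p_prime := pcharf_prime R_char.
have q_gt0 : (0 < q)%N by rewrite expn_gt0 prime_gt0.
elim/ltn_ind: n f => n IH f.
rewrite [in LHS](fps_split f) exprDn_pchar; last first.
  by rewrite (eq_pnat _ (pcharf_eq fps_pchar)) pnatX pnat_id.
rewrite exprMn -rmorphXn fps_coefD coef_fpsXnM.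
have [nq|qn] := ltnP n q.
  rewrite addr0; case: n nq {IH} => [|n] nq; first by rewrite dvdn0 div0n.
  by rewrite gtnNdvd.
have -> : coef (fps_const (coef f 0 ^+ q)) n = 0.
  by case: n qn {IH} => //; rewrite leqNgt q_gt0.
rewrite add0r IH; last by rewrite ltn_subrL q_gt0 (leq_trans q_gt0 qn).
rewrite -[in RHS](subnK qn) dvdn_addl // divnDr // divnn q_gt0 addn1.
by [].
Qed.

End FpsFrobenius.

Lemma ider_frobenius (K : idFieldType) p m (x : K) n : p \in [pchar K] ->
  ider n (x ^+ (p ^ m)) =
  if (p ^ m %| n)%N then ider (n %/ p ^ m)%N x ^+ (p ^ m) else 0.
Proof.
move=> K_char; rewrite -[LHS]/(coef (expD (x ^+ (p ^ m))) n) rmorphXn.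
exact: (coef_fps_frobenius K_char).
Qed.

Lemma ider_pth (K : idFieldType) p (x : K) i : p \in [pchar K] ->
  ider (p * i)%N (x ^+ p) = ider i x ^+ p.
Proof.
move=> K_char; have := ider_frobenius 1 x (p * i) K_char.
by rewrite expn1 dvdn_mulr // mulKn // (prime_gt0 (pcharf_prime K_char)).
Qed.

(** By induction the middle terms of the product rule vanish, so [ider i] acts on polynomials in [r]
    as an ordinary derivation, and [q'(r) * ider i r = 0]. *)
Lemma separable_root_constant (K : idFieldType) (D : fieldType)
    (j : {rmorphism D -> K}) (q : {poly D}) (r : K) :
  (forall c i, (0 < i)%N -> ider i (j c) = 0) ->
  root (map_poly j q) r -> ~~ root (map_poly j q^`()) r ->
  forall i, (0 < i)%N -> ider i r = 0.
Proof.
move=> jc /rootP qr dqr i.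
elim/ltn_ind: i => i IH i0.
have mulr_ider (y : K) : ider i (y * r) = y * ider i r + ider i y * r.
  rewrite iderM; case: i => // i in IH i0 *.
  rewrite big_ord_recl big_ord_recr /= big1 ?add0r => [|l _].
    by rewrite /bump /= add1n subnn subn0 !ider0.
  rewrite [X in _ * X]IH ?mulr0 //; last by rewrite subn_gt0 /bump /= add1n ltnS.
  by rewrite /bump /= add1n subSS ltnS leq_subr.
have E : ider i (map_poly j q).[r] = (map_poly j q^`()).[r] * ider i r.
  elim/poly_ind: q {qr dqr} => [|q c IHq].
    by rewrite deriv0 !rmorph0 !horner0 mul0r raddf0.
  rewrite derivMXaddC !rmorphD !rmorphM /= map_polyX map_polyC /=.
  by rewrite !hornerE raddfD /= mulr_ider IHq jc // addr0 mulrDl [_ * r * _]mulrAC.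
move: E; rewrite qr raddf0 => /esym/eqP; rewrite mulf_eq0.
by move: dqr; rewrite rootE => /negPf -> /eqP.
Qed.

Section PthRoots.
Variables (p : nat) (U : idFieldType) (U_SCH : SCH p U).

Let U_char : p \in [pchar U] := SCH_char U_SCH.
Let p_prime : prime p := pcharf_prime U_char.

Lemma frobenius_inj n (x y : U) : x ^+ (p ^ n) = y ^+ (p ^ n) -> x = y.
Proof.
move=> E; apply/eqP; rewrite -subr_eq0.
have : (x - y) ^+ (p ^ n) = 0.
  rewrite exprDn_pchar ?(eq_pnat _ (pcharf_eq U_char)) ?pnatX ?pnat_id //.
  by rewrite exprNn_pchar ?(eq_pnat _ (pcharf_eq U_char)) ?pnatX ?pnat_id // E subrr.
by move/eqP; rewrite expf_eq0 => /andP[].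
Qed.

(** A vanishing [ider 1] gives a [p]-th root, and [ider (p * i) (z ^+ p) = ider i z ^+ p] passes the
    remaining conditions on to it. *)
Lemma frobenius_root n (x : U) :
  (forall i, (0 < i < p ^ n)%N -> ider i x = 0) -> exists y, x = y ^+ (p ^ n).
Proof.
have p_gt0 := prime_gt0 p_prime; have p_gt1 := prime_gt1 p_prime.
elim: n x => [|n IH] x dx; first by exists x.
have [|z xz] := (SCH_strict U_SCH x).1.
  by apply: dx; rewrite /= -{1}(expn0 p) ltn_exp2l.
have [|y zy] := IH z.
  move=> i /andP[i0 ip]; have := dx (p * i)%N.
  rewrite xz ider_pth // muln_gt0 i0 p_gt0 expnS ltn_pmul2l // ip => /(_ isT)/eqP.
  by rewrite expf_eq0 => /andP[_ /eqP].
by exists y; rewrite xz zy -exprM expnSr.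
Qed.

Definition full_pred : {pred U} := predT.

Fact full_divring_closed : divring_closed full_pred.
Proof. by []. Qed.

HB.instance Definition _ := GRing.isDivringClosed.Build U full_pred full_divring_closed.

Definition full_idSubfield : idSubfield U :=
  @IDSubfield U full_pred (fun _ _ _ => isT).

Lemma constants_perfect (x : U) : x \in constants full_idSubfield ->
  exists y, y \in constants full_idSubfield /\ x = y ^+ p.
Proof.
have p_gt0 := prime_gt0 p_prime.
move=> /constantsP[_ cx]; have [|y xy] := (SCH_strict U_SCH x).1; first exact: cx.
exists y; split=> //; apply/constantsP; split=> // i i0.
have := cx (p * i)%N; rewrite muln_gt0 p_gt0 => /(_ i0).
rewrite xy ider_pth // => /eqP.
by rewrite expf_eq0 => /andP[_ /eqP].
Qed.

Local Notation D := (subfieldType (constantField full_idSubfield)).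

(** A separable polynomial has a root in [U], and it is constant. One with zero derivative is a
    [p]-th power, since constants have constant [p]-th roots. Otherwise the gcd with the derivative
    is a factor of smaller degree. *)
Lemma constants_closed : has_roots D.
Proof.
have U_roots := SCH_closed U_SCH.
have D_char : p \in [pchar D] by rewrite -(fmorph_pchar (val : {rmorphism D -> U})).
move=> q; have [n] := ubnP (size q); elim: n q => // n IH q /ltnSE szq q1.
have qnz : q != 0 by rewrite -size_poly_gt0 ltnW.
have [dq0|dqnz] := eqVneq q^`() 0.
  have /choice[rt rtE] (c : D) : exists y : D, c = y ^+ p.
    have [y [yD cy]] := constants_perfect (valP c).
    by exists (Sub y yD); apply: val_inj; rewrite cy rmorphXn.
  have qE i : ~~ (p %| i)%N -> q`_i = 0.
    move=> pi; case: i pi => [|i] pi; first by rewrite dvdn0 in pi.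
    have /eqP := congr1 (fun q : {poly D} => q`_i) dq0; rewrite coef_deriv coef0.
    rewrite -mulr_natr mulf_eq0 => /orP[/eqP //|].
    by rewrite -(dvdn_pcharf D_char) (negPf pi).
  pose s := \poly_(i < size q) rt q`_(p * i)%N.
  have p_gt1 := prime_gt1 p_prime; have p_gt0 := prime_gt0 p_prime.
  have rt0 : rt 0 = 0.
    by have /esym/eqP := rtE 0; rewrite expf_eq0 => /andP[_ /eqP].
  have sE i : s`_i = rt q`_(p * i)%N.
    rewrite coef_poly; case: ltnP => // szi.
    by rewrite nth_default ?rt0 // (leq_trans szi) // leq_pmull.
  have qs : q = s ^+ p.
    have polyD_char : p \in [pchar {poly D}] by rewrite pchar_poly.
    rewrite -(pFrobenius_autE polyD_char) /s poly_def rmorph_sum.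
    apply/polyP => m; rewrite coef_sum.
    have cE (i : 'I_(size q)) : (pFrobenius_aut polyD_char (rt q`_(p * i)%N *: 'X^i))`_m
        = q`_(p * i)%N * (m == (p * i)%N)%:R.
      by rewrite pFrobenius_autE exprZn -rtE -exprM coefZ coefXn mulnC.
    rewrite (eq_bigr _ (fun i _ => cE i)).
    have [/dvdnP[i]|pm] := boolP (p %| m)%N; last first.
      rewrite qE // big1 // => i _; have [mi|_] := eqVneq m (p * i)%N; last by rewrite mulr0.
      by rewrite mi dvdn_mulr in pm.
    rewrite mulnC => mi; have [iq|qi] := ltnP i (size q).
      rewrite (bigD1 (Ordinal iq)) //= mi eqxx mulr1 big1 ?addr0 // => l.
      rewrite -val_eqE /= => li; rewrite eqn_pmul2l // eq_sym (negPf li).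
      by rewrite mulr0.
    rewrite nth_default; last by rewrite mi (leq_trans qi) // leq_pmull.
    rewrite big1 // => l _; rewrite mi eqn_pmul2l //.
    by rewrite gtn_eqF ?mulr0 // (leq_trans _ qi).
  have szs : (size s < size q)%N.
    rewrite -(prednK (ltnW q1)) ltnS; apply/leq_sizeP => i qi.
    rewrite sE nth_default ?rt0 //; apply: (@leq_trans (i + i)).
      by rewrite -(prednK (ltnW q1)) -addn1 leq_add // (leq_trans _ qi) // -ltnS prednK // ltnW.
    by rewrite addnn -mul2n leq_mul2r p_gt1 orbT.
  have [||x sx] := IH s; first exact: leq_trans szs szq.
    rewrite ltnNge; apply/negP => s1; move: q1.
    by rewrite qs (size1_polyC s1) -rmorphXn size_polyC; case: (_ != _).
  by exists x; rewrite qs rootE horner_exp (rootP sx) expr0n -leqn0 leqNgt p_gt0.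
have [qsep|qnsep] := boolP (separable_poly q).
  have sz : size (map_poly (val : D -> U) q) = size q by rewrite size_map_poly.
  have [||r qr] := U_roots (map_poly val q); rewrite ?sz //.
    by rewrite separable_map.
  have rC : r \in constants full_idSubfield.
    apply/constantsP; split=> //; apply: (separable_root_constant _ qr).
      by move=> c; have /constantsP[] := valP c.
    move: qsep; rewrite -(separable_map (val : {rmorphism D -> U})) unlock.
    by rewrite deriv_map => /coprimep_root/(_ qr); rewrite rootE.
  by exists (Sub r rC); rewrite -(fmorph_root (val : {rmorphism D -> U})).
pose d := gcdp q q^`().
have [||x dx] := IH d.
- apply: leq_trans szq; apply: leq_ltn_trans (lt_size_deriv qnz).
  by rewrite dvdp_leq // dvdp_gcdr.
- move: qnsep; rewrite unlock /coprimep -/d neq_ltn ltnS leqn0 size_poly_eq0 gcdp_eq0.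
  by rewrite (negPf qnz).
by exists x; apply: root_dvdp dx; rewrite dvdp_gcdl.
Qed.

End PthRoots.

(** * Translating by constant points *)

Lemma closed_has_roots (K : fieldType) : GRing.closed_field_axiom K -> has_roots K.
Proof.
move=> closedK q q1; pose n := (size q).-1.
have n0 : (0 < n)%N by rewrite /n -ltnS prednK // ltnW.
have qn : (size q = n.+1)%N by rewrite /n prednK // ltnW.
have lq : q`_n != 0 by rewrite -lead_coefE lead_coef_eq0 -size_poly_gt0 ltnW.
have [x xn] := closedK n (fun i => - (q`_i / q`_n)) n0.
exists x; rewrite rootE horner_coef qn big_ord_recr /= xn mulr_sumr -big_split big1 //=.
by move=> i _; rewrite mulrA mulrN mulrCA mulfV // mulr1 mulNr subrr.
Qed.

Section FormalExtra.
Variables (K A S : comPzRingType).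

Lemma fev_flatten (j : K -> S) (psi : A -> S) (hs : seq (seq (K * A))) :
  fev j psi (flatten hs) = \sum_(h <- hs) fev j psi h.
Proof. by rewrite /fev big_flatten. Qed.

End FormalExtra.

Lemma clear_denominators (K0 K O A A' : comPzRingType) (g : {rmorphism K0 -> K})
    (N : A -> nat) (H : A -> seq (K * A')) (i : seq (K * A')) (h : seq (K0 * A)) :
  exists n Hh, forall (j : {rmorphism K -> O}) (psi : {rmorphism A' -> O}) (Phi : A -> O),
    (forall x, Phi x * fev j psi i ^+ N x = fev j psi (H x)) ->
    fev (j \o g) Phi h * fev j psi i ^+ n = fev j psi Hh.
Proof.
elim: h => [|y h [n [Hh hE]]].
  by exists 0, [::] => j psi Phi _; rewrite /fev !big_nil mul0r.
exists (n + N y.2)%N.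
exists (fmul [:: (g y.1, 1)] (fmul (H y.2) (fexp i n)) ++ fmul Hh (fexp i (N y.2))).
move=> j psi Phi PhiE; rewrite fev_cat !fev_mul !fev_exp fev_const -PhiE.
rewrite -(hE j psi Phi PhiE) {1}/fev big_cons -/(fev _ _ _) mulrDl exprD.
congr (_ + _); rewrite -!mulrA //; congr (_ * (_ * _)).
by rewrite mulrC.
Qed.

Section Density.
Variables (k : fieldType) (k_closed : has_roots k).
Variables (A : alg k) (A_fg : finitely_generated A).

(** Over independent coefficients, every component of [h] vanishes at all [k]-points; one that did
    not vanish at [psi] would be non-zero at some [k]-point by the Nullstellensatz. *)
Lemma points_dense (K O : fieldType) (e : {rmorphism k -> K})
    (j : {rmorphism K -> O}) (psi : {rmorphism A -> O}) (h : seq (K * A)) :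
  (forall c, psi (alg_str A c) = j (e c)) ->
  (forall chi : ahom A (Alg (idfun : {rmorphism k -> k})),
     fev (idfun : {rmorphism K -> K}) (e \o chi) h = 0) ->
  fev j psi h = 0.
Proof.
move=> psiE hk; have [q [nu [w [indep hE]]]] := independent_expansion e h.
rewrite (hE O j (j \o e) psi); first last.
- by move=> c x; rewrite rmorphM.
- by move=> x y; rewrite rmorphB.
rewrite big1 // => i _; rewrite [X in _ * X](_ : _ = 0) ?mulr0 //.
apply/eqP/negPn/negP => wi.
have [chi [_]] := nullstellensatz (e := idfun) (j := j \o e) A_fg k_closed psiE wi.
move/eqP; apply; move: i {wi}; apply: (indep (fun i => fev idfun chi (w i))).
rewrite -[RHS](hk chi) (hE K (idfun : {rmorphism K -> K}) e (e \o chi)) //.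
by apply: eq_bigr => i _; rewrite fev_comp mulrC.
Qed.

End Density.

Section ConstantMultiples.
Variables (U : idFieldType) (F : idSubfield U).
Local Notation k := (subfieldType (constantField F)).
Local Notation UA := (univ_alg F).
Variables (G : algebraic_group k) (alpha : arc_bundle G (base_alg F)).

Lemma nabla_constant (A : alg k) (u : gobj G A) (psi : ahom A UA) :
  (forall t i, (0 < i)%N -> ider i (psi t) = 0) ->
  nabla (gmap psi u) = arc_s (gmap psi u).
Proof.
move=> psic; rewrite /nabla /arc_s -!gmap_comp; congr (gmap _ _).
by apply: ahom_ext => t; apply: fpsP => -[|i] /=; [exact: ider0 | exact: psic].
Qed.

Lemma solves_mul (a c : gobj G UA) :
  solves alpha a -> nabla c = arc_s c -> solves alpha (a * c)%g.
Proof.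
rewrite /solves /logD /arc_h !arc_pi_nabla => <- cE.
rewrite /nabla /arc_s in cE *; rewrite !gmapM cE invgM mulgA.
by rewrite mulgK.
Qed.

End ConstantMultiples.

Section Subfields.
Variables (U : idFieldType) (F K : idSubfield U) (FK : {subset F <= K}).
Local Notation k := (subfieldType (constantField F)).
Local Notation FT := (subfieldType F).
Local Notation KT := (subfieldType K).
Local Notation D := (subfieldType (constantField K)).

Lemma constants_subset : {subset constantField F <= constantField K}.
Proof.
move=> x /constantsP[xF cx]; apply/constantsP; split=> //; exact: FK.
Qed.

Definition const_incl : {rmorphism k -> D} := sub_incl constants_subset.
Definition field_incl : {rmorphism k -> KT} :=
  sub_incl (fun x xC => FK (@constants_sub U F x xC)).
Definition const_val : {rmorphism D -> KT} := sub_incl (@constants_sub U K).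

Lemma const_valE c : const_val (const_incl c) = field_incl c.
Proof. exact: val_inj. Qed.

Definition const_hom : ahom (Alg const_incl) (Alg field_incl) :=
  field_hom const_valE.

Definition subfield_hom : ahom (Alg field_incl) (univ_alg F) :=
  @AHom k (Alg field_incl) (univ_alg F) (val : KT -> U) (fun _ => erefl).

Lemma constants_are_val : constants_are const_val.
Proof.
move=> x; split=> [cx|[c ->] i i0].
  have xC : val x \in constantField K.
    apply/constantsP; split; first exact: valP.
    by move=> i /cx /(congr1 val); rewrite rmorph0.
  by exists (Sub (val x) xC); apply: val_inj.
apply: val_inj; rewrite rmorph0.
by have /constantsP[_] := valP c; apply.
Qed.

End Subfields.

(** * Moving a point to a translate by constants *)

Section Move.
Variables (U : idFieldType) (F K : idSubfield U) (FK : {subset F <= K}).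
Local Notation k := (subfieldType (constantField F)).
Local Notation FT := (subfieldType F).
Local Notation KT := (subfieldType K).
Local Notation D := (subfieldType (constantField K)).
Local Notation UA := (univ_alg F).
Local Notation KA := (Alg (field_incl FK)).
Local Notation DA := (Alg (const_incl FK)).
Local Notation FtoK := (sub_incl FK : {rmorphism FT -> KT}).

Hypotheses (k_closed : has_roots k) (D_closed : has_roots D).
Variables (G : algebraic_group k) (alpha : arc_bundle G (base_alg F)).
Variables (a0 : gobj G KA) (a_sol : solves alpha (gmap (subfield_hom FK) a0)).
Variables (A : alg k) (u : points G A) (u_open : affine_open u).
Variable d : nat -> A -> seq (FT * A).
Hypothesis dE : forall phi : ahom A UA, solves alpha (gmap phi u) ->
  forall m t, ider m (phi t) = fev val phi (d m t).
Variables (O : fieldType) (jO : {rmorphism KT -> O}).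
Local Notation rhoO := (jO \o field_incl FK : {rmorphism k -> O}).
Local Notation OA := (Alg rhoO).
Variable phi0 : ahom A OA.

(** The value of this at a point with constant coordinates is [ider m] of the value of [h]. *)
Definition dcoef (m : nat) (T : Type) (h : seq (KT * T)) : seq (KT * T) :=
  [seq (ider m y.1, y.2) | y <- h].

(** A relation [h] at [a0 * x] is rewritten as a formal sum [H_ h] at [x]. Vanishing of all
    [dform m h] at [phi0] becomes vanishing of all [dcoef m (H_ h)] at [psi], to which
    [independent_ider] applies. *)
Lemma translate_to_constants :
  exists (c0 : gobj G DA) (Phi : ahom A UA),
    [/\ gmap Phi u = gmap (subfield_hom FK) (a0 * gmap (const_hom FK) c0)%g,
        solves alpha (gmap Phi u)
      & forall h : seq (FT * A),
      (forall m, fev (jO \o FtoK) phi0 (dform d m h) = 0) -> fev val Phi h = 0].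
Proof.
have rhoE c : jO (field_incl FK c) = rhoO c by [].
pose x0 : gobj G OA := ((gmap (field_hom rhoE) a0)^-1 * gmap phi0 u)%g.
have [_ [nch [ch [uch [ch_ok cover]]]]] := ag_variety G.
have [ic [psi psiE]] := cover O rhoO x0.
have [A'_fg _ _] := ch_ok ic.
set A' := ch ic in psi psiE A'_fg; set u' : gobj G A' := uch ic in psiE.
have psi_str c : psi (alg_str A' c) = jO (field_incl FK c) by rewrite ahom_str.
(* [None] is the point to be moved and [Some chi] are points over [K]; as one family they share the
   denominator [i] and the fractions. *)
pose pts (t : option (ahom A' KA)) : ahom A' OA :=
  if t is Some chi then ahom_comp (field_hom rhoE) chi else psi.
have phi0E : gmap phi0 u = (gmap (field_hom rhoE) a0 * gmap (pts None) u')%g.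
  by rewrite [gmap (pts None) u']psiE /x0 mulVKg.
have [i [N [H [i_psi near]]]] := local_translate u_open phi0E.
have phi0H x : phi0 x * fev jO psi i ^+ N x = fev jO psi (H x).
  have [Phi [PhiE PhiH]] := near None i_psi.
  have [u_inj _] := u_open; rewrite -PhiH; congr (_ * _).
  apply: u_inj. exact: (etrans phi0E (esym PhiE)).
have evK (chi : ahom A' KA) h :
    fev jO (pts (Some chi)) h = jO (fev (idfun : {rmorphism KT -> KT}) chi h).
  by rewrite fev_comp.
have nearK (chi : ahom A' KA) : fev (idfun : {rmorphism KT -> KT}) chi i != 0 ->
    exists Phi : ahom A KA, gmap Phi u = (a0 * gmap chi u')%g /\
    forall x, Phi x * fev (idfun : {rmorphism KT -> KT}) chi i ^+ N x =
              fev (idfun : {rmorphism KT -> KT}) chi (H x).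
  move=> chi_i; have [|Phi [PhiE PhiH]] := near (Some chi).
    by rewrite evK fmorph_eq0.
  rewrite gmap_comp -gmapM in PhiE.
  have [Phi1 Phi1E] := affine_open_descent u_open PhiE.
  exists Phi1; split=> // x; apply: (fmorph_inj jO).
  rewrite rmorphM rmorphXn -!evK -PhiH; congr (_ * _).
  have [u_inj _] := u_open.
  apply: (u_inj _ (ahom_comp (field_hom rhoE) Phi1)).
  by rewrite [LHS]fmap_comp Phi1E; apply: esym PhiE.
have sol_chi (chi : ahom A' KA) (Phi : ahom A KA) :
    (forall t m, (0 < m)%N -> ider m (chi t) = 0) ->
    gmap Phi u = (a0 * gmap chi u')%g ->
    solves alpha (gmap (ahom_comp (subfield_hom FK) Phi) u).
  move=> chic PhiE; rewrite gmap_comp PhiE gmapM; apply: solves_mul => //.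
  rewrite -gmap_comp; apply: nabla_constant => t m m0.
  by rewrite -[LHS]/(val (ider m (chi t))) chic // rmorph0.
have derPhi (chi : ahom A' KA) (Phi : ahom A KA) :
    (forall t m, (0 < m)%N -> ider m (chi t) = 0) ->
    gmap Phi u = (a0 * gmap chi u')%g ->
    forall m h, ider m (fev FtoK Phi h) = fev FtoK Phi (dform d m h).
  move=> chic PhiE m h; apply: val_inj.
  have valE h' : val (fev FtoK Phi h') = fev val (ahom_comp (subfield_hom FK) Phi) h'.
    by rewrite fev_comp.
  rewrite -[LHS]/(ider m (val (fev FtoK Phi h))) !valE; apply: dformE.
  by apply: dE; apply: sol_chi PhiE.
have derchi (chi : ahom A' KA) :
    (forall t m, (0 < m)%N -> ider m (chi t) = 0) ->
    forall m h, ider m (fev (idfun : {rmorphism KT -> KT}) chi h) =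
      fev (idfun : {rmorphism KT -> KT}) chi (dcoef m h).
  move=> chic m h; rewrite /dcoef fev_map /fev raddf_sum; apply: eq_bigr => y _ /=.
  rewrite mulrC iderM big_ord_recl ider0 subn0 big1 ?addr0 => [|l _].
    by rewrite mulrC.
  by rewrite chic ?mul0r.
have /choice[n_ /choice[H_ H_E]] :
    forall h : seq (FT * A), exists n, exists Hh : seq (KT * A'),
    forall (j : {rmorphism KT -> O}) (chi : {rmorphism A' -> O}) (Phi : A -> O),
    (forall x, Phi x * fev j chi i ^+ N x = fev j chi (H x)) ->
    fev (j \o FtoK) Phi h * fev j chi i ^+ n = fev j chi Hh.
  exact: clear_denominators.
have H_K (chi : ahom A' KA) (Phi : ahom A KA) h :
    (forall x, Phi x * fev (idfun : {rmorphism KT -> KT}) chi i ^+ N x =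
              fev (idfun : {rmorphism KT -> KT}) chi (H x)) ->
    fev FtoK Phi h * fev (idfun : {rmorphism KT -> KT}) chi i ^+ n_ h =
    fev (idfun : {rmorphism KT -> KT}) chi (H_ h).
  move=> PhiH; apply: (fmorph_inj jO); rewrite rmorphM rmorphXn -!evK fev_comp.
  by apply: H_E => x; rewrite !evK -PhiH rmorphM rmorphXn.
have key h : (forall m, fev (jO \o FtoK) phi0 (dform d m h) = 0) ->
    forall m, fev jO psi (dcoef m (H_ h)) = 0.
  move=> hker m; pose g l := dform d l h.
  pose M := \max_(l < m.+1) n_ (g l).
  pose rest (l : nat) : seq (KT * A') :=
    fmul (fmul (H_ (g l)) (fexp i (M - n_ (g l))))
         (dcoef (m - l) (fexp i (n_ h))).
  (* The product rule for [ider m] of [H_ h], which is [h] at the translate times [i ^+ n_ h]. The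
     power [M] clears the denominators of the derivatives, and the extra factor [i] makes [E] vanish
     also where [i] does. *)
  pose E := fmul i (fmul (fexp i M) (dcoef m (H_ h)) ++
                    fopp (flatten [seq rest l | l : 'I_m.+1])).
  have restE : fev jO psi (flatten [seq rest l | l : 'I_m.+1]) = 0.
    rewrite fev_flatten big_image big1 // => l _.
    by rewrite !fev_mul -(H_E _ jO psi phi0) // hker !mul0r.
  have : fev jO psi E = 0.
    (* [O] carries no derivation, so the product rule is used at [k]-points and carried to [psi] by
       density. *)
    apply: (points_dense k_closed A'_fg psi_str) => chi.
    pose chiK : ahom A' KA := 
      ahom_comp (@field_hom k k KT idfun (field_incl FK) (field_incl FK) (fun=> erefl)) chi.
    have chic t l : (0 < l)%N -> ider l (chiK t) = 0.
      move=> l0; apply: val_inj; rewrite rmorph0.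
      by have /constantsP[_] := valP (chi t); apply.
    have [chi_i|chi_i] := eqVneq (fev (idfun : {rmorphism KT -> KT}) chiK i) 0.
      by rewrite [LHS]fev_mul chi_i mul0r.
    have [Phi [PhiE PhiH]] := nearK chiK chi_i.
    rewrite -[LHS]/(fev (idfun : {rmorphism KT -> KT}) chiK E).
    rewrite /E fev_mul fev_cat fev_mul fev_opp fev_exp -derchi // -(H_K _ Phi) //.
    rewrite iderM mulr_sumr fev_flatten big_image -sumrB big1 ?mulr0 // => l _.
    rewrite (derPhi chiK) // /rest !fev_mul -(H_K _ Phi) // -derchi // !fev_exp.
    have nM : (n_ (g l) <= M)%N by apply: leq_bigmax.
    by rewrite -[in X in X - _](subnKC nM) exprD mulrCA !mulrA subrr.
  rewrite /E fev_mul fev_cat fev_mul fev_opp restE subr0 fev_exp.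
  move/eqP; rewrite !mulf_eq0 expf_eq0 (negPf i_psi) andbF /= => /eqP //.
have deltaC : constants_are (const_val K) := @constants_are_val U K.
have expO q nu (w : 'I_q -> seq (D * A')) h m : expands (const_val K) h nu w ->
    fev jO psi (dcoef m h) =
    \sum_i jO (ider m (nu i)) * fev (jO \o const_val K) psi (w i).
  move=> wE; rewrite fev_map (wE O (jO \o ider m) (jO \o const_val K) psi) //.
    by move=> x y; rewrite /= raddfB rmorphB.
  by move=> c x; rewrite /= (iderMc deltaC) rmorphM.
have expK q nu (w : 'I_q -> seq (D * A')) h (chi : ahom A' DA) :
    expands (const_val K) h nu w ->
    fev (idfun : {rmorphism KT -> KT}) (ahom_comp (const_hom FK) chi) h =
    \sum_i nu i * const_val K (fev idfun chi (w i)).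
  move=> wE; rewrite (wE KT (idfun : {rmorphism KT -> KT}) (const_val K)) //.
  by apply: eq_bigr => l _; rewrite fev_comp.
have [q [nu [w [indep wE]]]] := independent_expansion (const_val K) i.
(* A component of [i] kept non-zero ensures that the new constant point stays where the fractions
   are defined. *)
have [l wl] : exists l, fev (jO \o const_val K) psi (w l) != 0.
  apply: contrapT => no; move/eqP: i_psi; apply.
  transitivity (fev jO psi (dcoef 0 i)).
    by rewrite fev_map; apply: eq_fev => // x; rewrite /= ider0.
  rewrite (expO _ _ _ _ _ wE) big1 // => l _.
  suff -> : fev (jO \o const_val K) psi (w l) = 0 by rewrite mulr0.
  by apply: contrapT => /eqP wl; apply: no; exists l.
have psi_strD c : psi (alg_str A' c) = (jO \o const_val K) (const_incl FK c).
  by rewrite psi_str /= const_valE.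
have [chi [chi_ker chi_w]] := nullstellensatz A'_fg D_closed psi_strD wl.
pose chiK := ahom_comp (const_hom FK) chi.
have chic t m : (0 < m)%N -> ider m (chiK t) = 0.
  move=> m0; apply: (deltaC (chiK t)).2 m0.
  by exists (chi t).
have chi_i : fev (idfun : {rmorphism KT -> KT}) chiK i != 0.
  apply: contraNneq chi_w => chi_i; apply/eqP; move: l {wl}.
  apply: indep; rewrite -[RHS]chi_i (expK _ _ _ _ _ wE).
  by apply: eq_bigr => l _; rewrite mulrC.
have [Phi [PhiE PhiH]] := nearK chiK chi_i.
exists (gmap chi u'), (ahom_comp (subfield_hom FK) Phi); split.
- by rewrite gmap_comp PhiE -gmap_comp.
- exact: sol_chi chic PhiE.
move=> h /key hker.
have -> : fev val (ahom_comp (subfield_hom FK) Phi) h = val (fev FtoK Phi h).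
  by rewrite fev_comp.
suff -> : fev FtoK Phi h = 0 by rewrite rmorph0.
have [q1 [nu1 [w1 [indep1 w1E]]]] := independent_expansion (const_val K) (H_ h).
have w1_psi : forall l, fev (jO \o const_val K) psi (w1 l) = 0.
  apply: (independent_ider deltaC (j := jO) indep1) => m.
  by rewrite -(expO _ _ _ _ _ w1E).
have := H_K _ _ h PhiH; rewrite (expK _ _ _ _ _ w1E) big1.
  by move/eqP; rewrite mulf_eq0 expf_eq0 (negPf chi_i) andbF orbF => /eqP.
by move=> l' _; rewrite chi_ker ?rmorph0 ?mulr0 //; apply: w1_psi.
Qed.

End Move.

(** * Specialization of points *)

Lemma pigeonhole_nat n (c : nat -> 'I_n) :
  exists i, forall N, exists m, (N <= m)%N /\ c m = i.
Proof.
apply: contrapT => no.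
have /choice[N NE] (i : 'I_n) : exists N, forall m, (N <= m)%N -> c m <> i.
  apply: contrapT => noN; apply: no; exists i => N; apply: contrapT => nom.
  by apply: noN; exists N => m Nm cm; apply: nom; exists m.
pose M := \max_i N i; apply: (NE (c M) M) => //.
exact: leq_bigmax.
Qed.

Section TranslatedCharts.
Variables (k : fieldType) (G : group_functor k).
Local Notation kk := (Alg (idfun : {rmorphism k -> k})).
Variable w : gobj G kk.

Definition str_hom (A : alg k) : ahom kk A := @AHom k kk A (alg_str A) (fun=> erefl).

Definition const_point (A : alg k) : gobj G A := gmap (str_hom A) w.

Lemma gmap_const_point (A B : alg k) (f : ahom A B) :
  gmap f (const_point A) = const_point B.
Proof. by apply: gmapE => c; apply: ahom_str. Qed.

Lemma affine_open_mul (A : alg k) (u : points G A) :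
  affine_open u -> affine_open (X := points G) (u * const_point A : gobj G A)%g.
Proof.
move=> [u_inj u_open]; split.
  move=> B phi psi; rewrite [LHS]gmapM [RHS]gmapM !gmap_const_point => /mulIg.
  exact: u_inj.
move=> B x; have [I IP] := u_open B (x * (const_point B)^-1 : gobj G B)%g.
exists I => C phi; split=> [[psi _ psiE]|/IP[psi _ psiE]]; [apply/IP|]; exists psi => //.
  apply: (mulIg (const_point C)); rewrite [fmap phi _]gmapM -[in RHS]mulgA.
  rewrite -[X in (_ * (_ * X))%g](gmap_const_point phi) -gmapM mulVg gmap1 mulg1.
  by rewrite -[RHS]psiE [RHS]gmapM gmap_const_point.
rewrite [LHS]gmapM gmap_const_point [gmap psi u]psiE [fmap phi _]gmapM -mulgA.
by rewrite -[X in (_ * (_ * X))%g](gmap_const_point phi) -gmapM mulVg gmap1 mulg1.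
Qed.

End TranslatedCharts.

Section Specialization.
Variables (U : idFieldType) (F : idSubfield U).
Local Notation k := (subfieldType (constantField F)).
Local Notation FT := (subfieldType F).
Local Notation UA := (univ_alg F).
Local Notation eF := (sub_incl (@constants_sub U F) : {rmorphism k -> FT}).
Variable G : algebraic_group k.
Implicit Types g : gobj G UA.

Definition relations_le (A : alg k) (phi phi' : ahom A UA) : Prop :=
  forall h : seq (FT * A), fev val phi h = 0 -> fev val phi' h = 0.

(* [g'] lies in the Zariski closure over [F] of the point [g]. *)
Definition spec g g' : Prop :=
  forall (A : alg k) (u : points G A), affine_open u ->
  forall phi' : ahom A UA, gmap phi' u = g' ->
  exists phi : ahom A UA, gmap phi u = g /\ relations_le phi phi'.

Lemma spec_trans g1 g2 g3 : spec g1 g2 -> spec g2 g3 -> spec g1 g3.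
Proof.
move=> s12 s23 A u u_open phi3 /(s23 _ _ u_open)[phi2 [E2 r23]].
have [phi1 [E1 r12]] := s12 _ _ u_open _ E2.
by exists phi1; split=> // h /r12/r23.
Qed.

Lemma spec_chart (A : alg k) (u : points G A) (phi phi' : ahom A UA) :
  affine_open u -> spec (gmap phi u) (gmap phi' u) -> relations_le phi phi'.
Proof.
move=> u_open /(_ A u u_open phi' erefl)[phi1 [/(u_open.1 _ _ _) E r]] h h0.
by apply: r; rewrite -[RHS]h0; apply: eq_fev.
Qed.

(** One chart decides: the coordinates in another chart are fractions whose denominator is non-zero
    at [phi'], hence at [phi], since relations of [phi] hold at [phi']. *)
Lemma relations_spec (A : alg k) (u : points G A) (phi phi' : ahom A UA) :
  affine_open u -> relations_le phi phi' -> spec (gmap phi u) (gmap phi' u).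
Proof.
move=> u_open rel A2 u2 u2_open phi2 phi2E.
have rhoE c : (val : {rmorphism FT -> U}) (eF c) = (val : {rmorphism k -> U}) c by [].
pose pts (b : bool) := if b then phi else phi'.
have E1 : gmap phi2 u2 = (gmap (field_hom rhoE) (1 : gobj G (Alg eF)) *
    gmap (pts false) u)%g by rewrite gmap1 mul1g.
have [i [N [H [i_phi' near]]]] := local_translate u2_open E1.
have i_phi : fev (val : {rmorphism FT -> U}) (pts true) i != 0.
  by apply: contraNneq i_phi' => /rel ->.
have [Phi [PhiE PhiH]] := near true i_phi; rewrite gmap1 mul1g in PhiE.
have [Phi' [Phi'E Phi'H]] := near false i_phi'; rewrite gmap1 mul1g in Phi'E.
have phi2Phi' : phi2 =1 Phi'.
  by apply: u2_open.1; rewrite [LHS]phi2E -[RHS]/(gmap Phi' u2) Phi'E.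
exists Phi; split=> // h h0.
have [n [Hh HhE]] := clear_denominators U (idfun : {rmorphism FT -> FT}) N H i h.
have := HhE (val : {rmorphism FT -> U}) phi Phi PhiH.
rewrite -[fev _ Phi h]/(fev val Phi h) h0 mul0r => /esym/rel Hh0.
have := HhE (val : {rmorphism FT -> U}) phi' Phi' Phi'H.
rewrite Hh0 => /eqP; rewrite mulf_eq0 expf_eq0 [X in _ && X](negPf i_phi') andbF orbF.
by move=> /eqP <-; apply: eq_fev.
Qed.

Lemma spec_mul g g' (w : gobj G (Alg (idfun : {rmorphism k -> k}))) :
  spec g g' -> spec (g * const_point w UA)%g (g' * const_point w UA)%g.
Proof.
move=> s A u u_open phi' phi'E.
have u1_open := affine_open_mul w^-1%g u_open.
have constV B : const_point w^-1%g B = (const_point w B)^-1%g.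
  apply: (mulIg (const_point w B)); rewrite mulVg /const_point -gmapM mulVg.
  exact: gmap1.
have [|phi [phiE r]] := s A _ u1_open phi'.
  by rewrite gmapM gmap_const_point phi'E constV mulgK.
exists phi; split=> //; rewrite -phiE gmapM gmap_const_point constV.
by rewrite mulgVK.
Qed.

(** Some chart contains infinitely many [g n], hence all, because it contains every point that
    specializes into it. There the ideals of relations form an ascending chain. *)
Lemma spec_noetherian (g : nat -> gobj G UA) :
  (forall n, spec (g n) (g n.+1)) -> exists n, spec (g n.+1) (g n).
Proof.
move=> gS; have [_ [nch [ch [u [ch_ok cover]]]]] := ag_variety G.
have /choice[c cE] n : exists i : 'I_nch, exists phi : ahom (ch i) UA,
    gmap phi (u i) = g n by exact: cover.
have [i iinf] := pigeonhole_nat c.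
have specs m n : (m < n)%N -> spec (g m) (g n).
  elim: n => // n IH; rewrite ltnS leq_eqVlt => /orP[/eqP->//|/IH mn].
  exact: spec_trans mn (gS n).
have [fg _ u_open] := ch_ok i.
have /choice[phi phiE] n : exists phi : ahom (ch i) UA, gmap phi (u i) = g n.
  have [m [nm cm]] := iinf n.+1.
  have [phi phiE] : exists phi : ahom (ch i) UA, gmap phi (u i) = g m.
    by rewrite -cm; apply: cE.
  by have [phi1 []] := specs _ _ nm _ _ u_open _ phiE; exists phi1.
have [d [s rep]] := fg_multipoly fg.
pose P n (p : multipoly d FT) := mp_eval d (val : {rmorphism FT -> U}) (phi n \o s) p = 0.
have [||N NE] := noetherian_multipoly (I := P).
- move=> n; split; rewrite /P.
  + by rewrite rmorph0.
  + by move=> x y x0 y0; rewrite rmorphD x0 y0 addr0.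
  + by move=> a x x0; rewrite rmorphM x0 mulr0.
- move=> n p; rewrite /P; have [h hE] := fev_multipoly s p.
  rewrite !hE; apply: spec_chart u_open _ _.
  by rewrite !phiE.
exists N; rewrite -!phiE; apply: (relations_spec u_open) => h.
have /choice[Q QE] := rep FT eF.
pose p : multipoly d FT := \sum_(y <- h) mp_const d y.1 * Q y.2.
have pE (psi : ahom (ch i) UA) :
    mp_eval d (val : {rmorphism FT -> U}) (psi \o s) p = fev val psi h.
  rewrite rmorph_sum; apply: eq_bigr => y _; rewrite rmorphM mp_eval_const.
  by rewrite -QE // => x; rewrite ahom_str.
by rewrite -!pE => /(NE _ _ (leqnSn N)).
Qed.

End Specialization.

(** * Fields generated by a point *)

Section RootClosure.
Variables (p : nat) (U : idFieldType) (U_char : p \in [pchar U]).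
Variable L : idSubfield U.

Definition proot_pred : {pred U} := fun x => `[< exists n, x ^+ (p ^ n) \in L >].

Lemma proot_predP x : reflect (exists n, x ^+ (p ^ n) \in L) (x \in proot_pred).
Proof. exact: asboolP. Qed.

Lemma proot_mono (x : U) n m : x ^+ (p ^ n) \in L -> x ^+ (p ^ (n + m)) \in L.
Proof. by move=> xL; rewrite expnD exprM rpredX. Qed.

Fact proot_divring_closed : divring_closed proot_pred.
Proof.
split.
- by apply/proot_predP; exists 0; rewrite expr1n rpred1.
- move=> x y /proot_predP[n xL] /proot_predP[m yL]; apply/proot_predP; exists (n + m)%N.
  have pn : [char U].-nat (p ^ (n + m))%N.
    by rewrite (eq_pnat _ (pcharf_eq U_char)) pnatX pnat_id // (pcharf_prime U_char).
  rewrite exprDn_pchar // exprNn_pchar // rpredB ?(proot_mono m xL) //.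
  by rewrite addnC proot_mono.
- move=> x y /proot_predP[n xL] /proot_predP[m yL]; apply/proot_predP; exists (n + m)%N.
  by rewrite exprMn exprVn rpred_div ?(proot_mono m xL) // addnC proot_mono.
Qed.

HB.instance Definition _ := GRing.isDivringClosed.Build U proot_pred proot_divring_closed.

Fact proot_stable i x : x \in proot_pred -> ider i x \in proot_pred.
Proof.
move=> /proot_predP[n xL]; apply/proot_predP; exists n.
have := ider_frobenius n x (p ^ n * i) U_char.
rewrite dvdn_mulr // mulKn ?expn_gt0 ?prime_gt0 ?(pcharf_prime U_char) // => <-.
exact: idsub_stable.
Qed.

Definition proot_idSubfield : idSubfield U := @IDSubfield U proot_pred proot_stable.

Lemma proot_idSubfieldE : [set` proot_idSubfield] = proot_closure p [set` L].
Proof. by apply/seteqP; split=> x /=; [move/proot_predP|move=> xL; apply/proot_predP]. Qed.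

Lemma sub_proot x : x \in L -> x \in proot_idSubfield.
Proof. by move=> xL; apply/proot_predP; exists 0. Qed.

End RootClosure.

Section ChartField.
Variables (U : idFieldType) (F : idSubfield U).
Local Notation k := (subfieldType (constantField F)).
Local Notation FT := (subfieldType F).
Local Notation UA := (univ_alg F).
Local Notation vF := (val : {rmorphism FT -> U}).
Local Notation eF := (sub_incl (@constants_sub U F) : {rmorphism k -> FT}).
Variables (G : algebraic_group k) (A : alg k) (phi : ahom A UA).
Local Notation ev := (fev vF phi).

Definition frac_pred : {pred U} := fun x =>
  `[< exists h1 h2 : seq (FT * A), ev h2 != 0 /\ x * ev h2 = ev h1 >].

Lemma frac_predP x : reflect (exists h1 h2 : seq (FT * A),
  ev h2 != 0 /\ x * ev h2 = ev h1) (x \in frac_pred).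
Proof. exact: asboolP. Qed.

Fact frac_divring_closed : divring_closed frac_pred.
Proof.
have one0 : ev [:: (1, 1)] != 0 by rewrite fev_one oner_neq0.
split.
- by apply/frac_predP; exists [:: (1, 1)], [:: (1, 1)]; rewrite mul1r.
- move=> x y /frac_predP[h1 [h2 [h20 xE]]] /frac_predP[g1 [g2 [g20 yE]]].
  apply/frac_predP; exists (fmul h1 g2 ++ fopp (fmul g1 h2)), (fmul h2 g2).
  rewrite fev_cat fev_opp !fev_mul mulf_neq0 // -xE -yE; split=> //.
  by rewrite mulrBl mulrA; congr (_ - _); rewrite -!mulrA [ev h2 * _]mulrC.
- move=> x y /frac_predP[h1 [h2 [h20 xE]]] /frac_predP[g1 [g2 [g20 yE]]].
  have [->|y0] := eqVneq y 0.
    by apply/frac_predP; exists [::], [:: (1, 1)]; rewrite invr0 mulr0 mul0r fev_nil.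
  apply/frac_predP; exists (fmul h1 g2), (fmul h2 g1).
  rewrite !fev_mul -xE -yE !mulf_neq0 //; split=> //.
  by rewrite !mulrA; congr (_ * _); rewrite mulrAC mulfVK // mulrAC.
Qed.

HB.instance Definition _ := GRing.isDivringClosed.Build U frac_pred frac_divring_closed.

Lemma ev_frac h : ev h \in frac_pred.
Proof.
apply/frac_predP; exists h, [:: (1, 1)].
by rewrite fev_one oner_neq0 mulr1.
Qed.

Lemma sub_frac : {subset F <= frac_pred}.
Proof.
move=> x xF; have := ev_frac [:: ((Sub x xF : FT), 1)].
by rewrite fev_const.
Qed.

Lemma chart_frac t : phi t \in frac_pred.
Proof. by have := ev_frac [:: (1, t)]; rewrite fev_elt. Qed.

Lemma coordinates_frac (u : points G A) x :
  coordinates (X := points G) (gmap phi u) x -> x \in frac_pred.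
Proof.
move=> [A2 [u2 [phi2 [u2_open phi2E [f <-]]]]].
have rhoE c : vF (eF c) = (val : {rmorphism k -> U}) c by [].
pose pts (_ : unit) := phi.
have E1 : gmap phi2 u2 = (gmap (field_hom rhoE) (1 : gobj G (Alg eF)) *
    gmap (pts tt) u)%g by rewrite gmap1 mul1g.
have [i [N [H [i_phi near]]]] := local_translate u2_open E1.
have [Phi [PhiE PhiH]] := near tt i_phi; rewrite gmap1 mul1g in PhiE.
have -> : phi2 f = Phi f by apply: u2_open.1; exact: etrans phi2E (esym PhiE).
apply/frac_predP; exists (H f), (fexp i (N f)).
by rewrite fev_exp -PhiH expf_neq0.
Qed.

Section Stable.
Variable d : nat -> seq (FT * A) -> seq (FT * A).
Hypothesis dE : forall m h, ider m (ev h) = ev (d m h).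

Fact frac_stable i x : x \in frac_pred -> ider i x \in frac_pred.
Proof.
move=> /frac_predP[h1 [h2 [h20 xE]]].
elim/ltn_ind: i => i IH; have := iderM i x (ev h2).
rewrite xE big_ord_recr subnn ider0 /= => /eqP; rewrite addrC -subr_eq => /eqP E.
rewrite -(mulfK h20 (ider i x)) -E rpred_div ?ev_frac // rpredB ?dE ?ev_frac //.
by apply: rpred_sum => l _; rewrite rpredM ?IH // dE ev_frac.
Qed.

Definition frac_idSubfield : idSubfield U := @IDSubfield U frac_pred frac_stable.

(** Derivatives of the coordinates are again formal sums in them, so the fractions already form a
    differential field. *)
Lemma idgen_frac (u : points G A) : affine_open u ->
  idgen ([set` F] `|` coordinates (X := points G) (gmap phi u)) = [set` frac_idSubfield].
Proof.
move=> u_open; apply/seteqP; split=> x /=.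
  move=> /(_ frac_idSubfield); apply=> y [/= yF|yc]; first exact: sub_frac.
  exact: coordinates_frac yc.
move=> /frac_predP[h1 [h2 [h20 xE]]] K /= KF.
have evK h : ev h \in K.
  apply: rpred_sum => y _; apply: rpredM.
    by apply: KF; left; exact: (valP y.1).
  by apply: KF; right; exists A, u, phi; split=> //; exists y.2.
by rewrite -(mulfK h20 x) xE rpred_div.
Qed.

End Stable.
End ChartField.

(** * Constants outside [F] are transcendental over [F] *)

Lemma has_roots_infinite (k : fieldType) : has_roots k ->
  forall n, exists s : seq k, uniq s /\ size s = n.
Proof.
move=> k_closed; elim=> [|n [s [s_uniq sn]]]; first by exists [::].
(* Euclid's argument: a root of [P + 1] is not in [s]. The factor ['X] keeps the degree positive
   when [s] is empty. *)
pose P := \prod_(a <- s) ('X - a%:P) * 'X : {poly k}.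
have sP : size P = n.+2.
  by rewrite size_mulX ?monic_neq0 ?monic_prod_XsubC // size_prod_XsubC sn.
have sQ : size (P + 1) = n.+2 by rewrite size_polyDl sP ?size_poly1.
have [|r /rootP] := k_closed (P + 1); first by rewrite sQ.
rewrite hornerD hornerC hornerM hornerX => rE.
exists (r :: s); rewrite /= s_uniq andbT sn; split=> //.
apply/negP; rewrite -root_prod_XsubC => /rootP r0; move/eqP: rE.
by rewrite r0 mul0r add0r oner_eq0.
Qed.

Lemma nonroot_in_closed (k K : fieldType) (e : {rmorphism k -> K}) (u : {poly K}) :
  has_roots k -> u != 0 -> exists c, u.[e c] != 0.
Proof.
move=> k_closed unz; apply: contrapT => no.
have [s [s_uniq sn]] := has_roots_infinite k_closed (size u).
have : (size (map e s) < size u)%N.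
  apply: max_poly_roots => //; last by rewrite map_inj_uniq //; apply: fmorph_inj.
  apply/allP => _ /mapP[c _ ->]; apply/negPn/negP => uc; apply: no.
  by exists c.
by rewrite size_map sn ltnn.
Qed.

Lemma closed_algebraic (k K : fieldType) (e : {rmorphism k -> K}) (q : {poly k}) x :
  has_roots k -> q != 0 -> root (map_poly e q) x -> exists c, x = e c.
Proof.
move=> k_closed; have [n] := ubnP (size q); elim: n q => // n IH q /ltnSE szq q0 qx.
have q1 : (1 < size q)%N.
  rewrite -(size_map_poly e); apply: root_size_gt1 qx.
  by rewrite map_poly_eq0.
have [r /factor_theorem[q' qE]] := k_closed q q1.
have q'0 : q' != 0 by apply: contraNneq q0 => q'0; rewrite qE q'0 mul0r.
move: qx; rewrite qE rmorphM /= rmorphB /= map_polyX map_polyC /= rootM root_XsubC.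
case/orP => [q'x|/eqP->]; last by exists r.
apply: (IH q') => //; apply: leq_trans szq.
by rewrite qE size_Mmonic ?monicXsubC // size_XsubC addn2.
Qed.

(** Polynomials as formal sums indexed by exponents, on which [independent_expansion] can act. *)
Definition poly_of_terms (k : nzRingType) (h : seq (k * nat)) : {poly k} :=
  \sum_(y <- h) y.1 *: 'X^(y.2).

Lemma map_poly_of_terms (k K : comNzRingType) (j : {rmorphism k -> K}) h :
  map_poly j (poly_of_terms h) = fev (polyC \o j) (fun i => 'X^i) h.
Proof.
rewrite /poly_of_terms rmorph_sum; apply: eq_bigr => y _.
by rewrite /= map_polyZ map_polyXn mul_polyC.
Qed.

Lemma horner_poly_of_terms (k K : comNzRingType) (j : {rmorphism k -> K}) x h :
  (map_poly j (poly_of_terms h)).[x] = fev j (fun i => x ^+ i) h.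
Proof.
rewrite map_poly_of_terms horner_sum; apply: eq_bigr => y _.
by rewrite /= mul_polyC hornerZ hornerXn.
Qed.

Section Existence.
Variables (U : idFieldType) (F : idSubfield U).
Local Notation k := (subfieldType (constantField F)).
Local Notation FT := (subfieldType F).
Local Notation UA := (univ_alg F).
Local Notation vF := (val : {rmorphism FT -> U}).
Local Notation eF := (sub_incl (@constants_sub U F) : {rmorphism k -> FT}).
Variables (G : algebraic_group k).

Lemma factor_subfield (K : idSubfield U) (FK : {subset F <= K}) (A : alg k)
    (psi : ahom A UA) : (forall t, psi t \in K) ->
  exists psi0 : ahom A (Alg (field_incl FK)), forall t, val (psi0 t) = psi t.
Proof.
move=> psiK; pose f t : subfieldType K := Sub (psi t) (psiK t).
have f_zmod : zmod_morphism f by move=> x y; apply: val_inj; rewrite rmorphB /= rmorphB.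
have f_monoid : monoid_morphism f.
  by split=> [|x y]; apply: val_inj; rewrite ?rmorph1 ?rmorphM /= ?rmorph1 ?rmorphM.
pose fZ := GRing.isZmodMorphism.Build A (subfieldType K) f f_zmod.
pose fM := GRing.isMonoidMorphism.Build A (subfieldType K) f f_monoid.
pose fR : {rmorphism A -> subfieldType K} := HB.pack f fZ fM.
have f_str c : fR (alg_str A c) = field_incl FK c by apply: val_inj; apply: (ahom_str psi c).
by exists (@AHom k A (Alg (field_incl FK)) fR f_str).
Qed.

(** Expand [u] over the constants of [F]. Its components take constant values at [gamma], so
    differentiating [u(gamma) = 0] gives a system that forces them to vanish there; a non-zero
    component makes [gamma] algebraic over the closed field [k]. *)
Lemma constant_transcendental (gamma : U) (u : {poly FT}) : has_roots k ->
  (forall i, (0 < i)%N -> ider i gamma = 0) -> gamma \notin F ->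
  u != 0 -> (map_poly vF u).[gamma] != 0.
Proof.
move=> k_closed gc gF unz; apply: contraNneq gF => ug.
pose h : seq (FT * nat) := [seq (u`_i, i) | i <- index_iota 0 (size u)].
have hE (S : comPzRingType) (j : FT -> S) psi :
    fev j psi h = \sum_(i < size u) j u`_i * psi i.
  by rewrite /fev big_map big_mkord.
have [q [nu [w [indep wE]]]] := independent_expansion eF h.
have deltaC : constants_are eF := @constants_are_val U F.
have gXc n i : (0 < i)%N -> ider i (gamma ^+ n) = 0.
  elim: n i => [|n IH] i i0; first by rewrite expr0 ider1.
  rewrite exprS iderM big1 // => -[[|l] li] _ /=; last by rewrite gc // mul0r.
  by rewrite subn0 IH // mulr0.
have Pc h' i : (0 < i)%N -> ider i (fev (vF \o eF) (fun i => gamma ^+ i) h') = 0.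
  move=> i0; rewrite /fev raddf_sum big1 // => y _ /=.
  rewrite iderM big1 // => -[[|l] li] _ /=.
    by rewrite subn0 gXc // mulr0.
  by have /constantsP[_ ->] := valP y.1; rewrite ?mul0r.
have kill i : fev (vF \o eF) (fun i => gamma ^+ i) (w i) = 0.
  move: i; apply: (independent_ider deltaC (j := vF) indep) => m.
  have sum0 : \sum_i vF (nu i) * fev (vF \o eF) (fun i => gamma ^+ i) (w i) = 0.
    rewrite -(wE U vF (vF \o eF) (fun i => gamma ^+ i)).
    - rewrite hE -[RHS]ug horner_coef size_map_poly.
      by apply: eq_bigr => i _; rewrite coef_map.
    - by move=> x y; rewrite rmorphB.
    - by move=> c x; rewrite rmorphM.
  transitivity (ider m (\sum_i vF (nu i) * fev (vF \o eF) (fun i => gamma ^+ i) (w i))).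
    rewrite raddf_sum; apply: eq_bigr => i _ /=.
    rewrite mulrC [in RHS]mulrC iderM big_ord_recl ider0 subn0 big1 ?addr0 // => l _.
    by rewrite Pc ?mul0r.
  by rewrite sum0 raddf0.
have [i Pi] : exists i, poly_of_terms (w i) != 0.
  apply: contrapT => no; move/eqP: unz; apply.
  have -> : u = fev polyC (fun i => 'X^i) h.
    by rewrite hE -[LHS]coefK poly_def; apply: eq_bigr => i _; rewrite mul_polyC.
  rewrite (wE {poly FT} polyC (polyC \o eF)) ?big1 //.
  - move=> i _; rewrite -map_poly_of_terms.
    have /eqP -> : poly_of_terms (w i) == 0.
      by apply/negPn/negP => Pi; apply: no; exists i.
    by rewrite rmorph0 mulr0.
  - by move=> x y; rewrite rmorphB.
  - by move=> c x; rewrite rmorphM.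
have /(closed_algebraic k_closed Pi)[c ->] :
    root (map_poly (vF \o eF) (poly_of_terms (w i))) gamma.
  by apply/rootP; rewrite horner_poly_of_terms kill.
exact: (valP (eF c)).
Qed.

End Existence.

(** * Existence *)

Section Existence.
Variables (p : nat) (U : idFieldType) (U_SCH : SCH p U) (F : idSubfield U).
Local Notation k := (subfieldType (constantField F)).
Local Notation FT := (subfieldType F).
Local Notation UA := (univ_alg F).
Local Notation vF := (val : {rmorphism FT -> U}).
Local Notation eF := (sub_incl (@constants_sub U F) : {rmorphism k -> FT}).
Hypothesis k_closed : has_roots k.
Variables (G : algebraic_group k) (alpha : arc_bundle G (base_alg F)).
Hypothesis alpha_e : arc_e alpha.

Lemma maximal_solution : consistent alpha ->
  exists b, solves alpha b /\ forall b', solves alpha b' -> spec b b' -> spec b' b.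
Proof.
move=> [b0 b0_sol]; apply: contrapT => no.
have /choice[f fE] (b : {b | solves alpha b}) : exists b' : {b | solves alpha b},
    spec (sval b) (sval b') /\ ~ spec (sval b') (sval b).
  apply: contrapT => nob; apply: no; exists (sval b); split; first exact: svalP.
  move=> b' b'_sol bb'; apply: contrapT => b'b.
  by apply: nob; exists (exist _ b' b'_sol).
pose g n := iter n f (exist _ b0 b0_sol).
have [|n] := @spec_noetherian _ _ _ (fun n => sval (g n)).
  by move=> n; apply: (fE (g n)).1.
exact: (fE (g n)).2.
Qed.

Lemma maximal_no_new_constants (A : alg k) (u : points G A) (phi : ahom A UA) :
  finitely_generated A -> affine_open u -> solves alpha (gmap phi u) ->
  (forall b', solves alpha b' -> spec (gmap phi u) b' -> spec b' (gmap phi u)) ->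
  forall x, x \in frac_pred phi -> (forall i, (0 < i)%N -> ider i x = 0) -> x \in F.
Proof.
move=> A_fg u_open phi_sol phi_max gamma /frac_predP[f [g [g0 fg]]] gc.
apply: contrapT => /negP gF.
have phiE c : phi (alg_str A c) = vF (eF c) by rewrite ahom_str.
have trans v : v != 0 -> (map_poly vF v).[gamma] != 0.
  exact: constant_transcendental.
have [v [vnz main]] := specialize_transcendental A_fg phiE trans.
have [c vc] := nonroot_in_closed eF k_closed vnz.
have [O [i [theta [thetaE theta_rel]]]] := main _ vc U vF.
pose K := full_idSubfield U.
have FK : {subset F <= K} by [].
have [phi0 phi0E] := factor_subfield FK (psi := phi) (fun _ => isT).
have [d dE] := uniform_derivative alpha_e u_open.
pose jO : {rmorphism subfieldType K -> O} := i \o val.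
pose theta0 : ahom A (Alg (jO \o field_incl FK)) :=
  @AHom k A (Alg (jO \o field_incl FK)) theta thetaE.
have a0E : gmap (subfield_hom FK) (gmap phi0 u) = gmap phi u by apply: gmapE.
have a_sol : solves alpha (gmap (subfield_hom FK) (gmap phi0 u)) by rewrite a0E.
have [c0 [Phi [_ Phi_sol PhiE]]] := translate_to_constants k_closed
  (constants_closed U_SCH) a_sol u_open dE theta0.
have {}dE := dformE (dE phi phi_sol).
have {}PhiE h : (forall m, fev (i \o vF) theta (dform d m h) = 0) -> fev vF Phi h = 0.
  by move=> h0; apply: PhiE => m; rewrite -[RHS](h0 m); apply: eq_fev.
have relE : relations_le phi Phi.
  move=> h h0; apply: PhiE => m.
  rewrite (theta_rel _ [::]) ?fev_nil ?mulr0 //.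
  by rewrite -dE h0 raddf0.
(* By maximality every relation of [Phi] holds at [phi]. This is applied to [f - c * g], whose value
   at [phi] is [gamma - c] times that of [g]. *)
have := spec_chart u_open (phi_max _ Phi_sol (relations_spec u_open relE)).
pose g' := fscale (- eF c) g => /(_ (f ++ g')).
have evg' : fev vF phi g' = - (val c * fev vF phi g).
  by rewrite fev_scale rmorphN mulNr.
have gc' m : ider m (gamma * fev vF phi g) = gamma * ider m (fev vF phi g).
  rewrite iderM big_ord_recl ider0 subn0 big1 ?addr0 // => l _.
  by rewrite gc ?mul0r.
have cc' m : ider m (val c * fev vF phi g) = val c * ider m (fev vF phi g).
  have /constantsP[_ cc] := valP c.
  rewrite iderM big_ord_recl ider0 subn0 big1 ?addr0 // => l _.
  by rewrite cc ?mul0r.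
have evfg : fev vF phi (f ++ g') = (gamma - val c) * fev vF phi g.
  by rewrite fev_cat evg' -fg mulrBl.
have PhiFG : fev vF Phi (f ++ g') = 0.
  (* At [phi] the [m]-th derivative of [f - c * g], plus [c] times that of [g], is [gamma] times
     that of [g]; [theta] replaces [gamma] by [c], which leaves zero. *)
  apply: PhiE => m; pose e := fscale (eF c) (dform d m g).
  have := theta_rel (dform d m (f ++ g') ++ e) (dform d m g).
  rewrite 2!fev_cat /e 2!fev_scale -!dE evfg mulrBl raddfB /= gc' cc' subrK.
  by move=> /(_ erefl)/eqP; rewrite -subr_eq0 addrK => /eqP.
rewrite evfg => /(_ PhiFG)/eqP; rewrite mulf_eq0 (negPf g0) orbF subr_eq0 => /eqP gE.
by move/negP: gF; apply; rewrite gE; apply: (valP (eF c)).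
Qed.

(** A power [x ^+ (p ^ n)] is a constant of [L], hence lies in [C_F]; the root it has in that closed
    field must be [x], by injectivity of Frobenius. *)
Lemma proot_constants (L : idSubfield U) : {subset F <= L} ->
  (forall x, x \in L -> (forall i, (0 < i)%N -> ider i x = 0) -> x \in F) ->
  constants (proot_idSubfield (SCH_char U_SCH) L) =i constants F.
Proof.
move=> FL Lconst x; apply/idP/idP => /constantsP[xL cx]; apply/constantsP; split=> //.
  have /proot_predP[n xn] := xL.
  have cxn i : (0 < i)%N -> ider i (x ^+ (p ^ n)) = 0.
    move=> i0; rewrite (ider_frobenius _ _ _ (SCH_char U_SCH)).
    case: ifP => // /dvdnP[m im]; rewrite im mulnK; last first.
      by rewrite expn_gt0 prime_gt0 // (pcharf_prime (SCH_char U_SCH)).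
    rewrite cx ?expr0n; last by move: i0; rewrite im muln_gt0 => /andP[].
    by rewrite expn_eq0 (gtn_eqF (prime_gt0 (pcharf_prime (SCH_char U_SCH)))).
  have xnC : x ^+ (p ^ n) \in constantField F.
    by apply/constantsP; split=> //; apply: Lconst.
  pose q : {poly k} := 'X^(p ^ n) - (Sub (x ^+ (p ^ n)) xnC : k)%:P.
  have pn0 : (0 < p ^ n)%N by rewrite expn_gt0 prime_gt0 // (pcharf_prime (SCH_char U_SCH)).
  have [|y] := k_closed (q := q).
    by rewrite /q size_XnsubC.
  rewrite rootE !hornerE subr_eq0 => /eqP /(congr1 val); rewrite rmorphXn /=.
  move/(frobenius_inj U_SCH) => <-.
  by have /constantsP[] := valP y.
by apply: sub_proot; apply: FL.
Qed.

Theorem idGalois_extension_exists : consistent alpha ->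
  exists K : idSubfield U, idGalois_extension p alpha K.
Proof.
move=> /maximal_solution[b [b_sol b_max]].
have [_ [nch [ch [u [ch_ok cover]]]]] := ag_variety G.
have [i [phi phiE]] := cover U (val : {rmorphism k -> U}) b.
have [A_fg _ u_open] := ch_ok i.
have [d dE] := uniform_derivative alpha_e u_open.
rewrite -phiE in b_sol b_max.
pose L := frac_idSubfield (dformE (dE phi b_sol)).
exists (proot_idSubfield (SCH_char U_SCH) L), (gmap phi (u i)); split=> //.
  by rewrite proot_idSubfieldE (idgen_frac (dformE (dE phi b_sol)) u_open).
apply: proot_constants; first exact: sub_frac.
exact: maximal_no_new_constants b_max.
Qed.

End Existence.

(** * Uniqueness *)

Section Correspondence.
Variables (p : nat) (U : idFieldType) (U_SCH : SCH p U) (F : idSubfield U).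
Local Notation k := (subfieldType (constantField F)).
Local Notation FT := (subfieldType F).
Local Notation UA := (univ_alg F).
Local Notation vF := (val : {rmorphism FT -> U}).
Variables (A : alg k) (d : nat -> seq (FT * A) -> seq (FT * A)).

Definition derives (phi : ahom A UA) : Prop :=
  forall m h, ider m (fev vF phi h) = fev vF phi (d m h).

(** The graph of the intended isomorphism. As a relation it respects the operations before being
    known single-valued, and single-valuedness then reduces to the image of zero. *)
Definition frac_corr (phi psi : ahom A UA) (x y : U) : Prop :=
  exists h1 h2 : seq (FT * A), [/\ fev vF phi h2 != 0,
    x * fev vF phi h2 = fev vF phi h1 & y * fev vF psi h2 = fev vF psi h1].

Definition corr (phi psi : ahom A UA) (x y : U) : Prop :=
  exists n, frac_corr phi psi (x ^+ (p ^ n)) (y ^+ (p ^ n)).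

Section Closure.
Variables (phi psi : ahom A UA).
Hypotheses (le : relations_le phi psi) (ge : relations_le psi phi).
Hypotheses (phi_der : derives phi) (psi_der : derives psi).
Local Notation ev1 := (fev vF phi).
Local Notation ev2 := (fev vF psi).
Local Notation R0 := (frac_corr phi psi).
Local Notation R := (corr phi psi).
Let U_char := SCH_char U_SCH.
Let p_prime := pcharf_prime U_char.

Lemma ev_neq0 h : ev1 h != 0 -> ev2 h != 0.
Proof. by apply: contraNneq => /ge ->. Qed.

Lemma frac_corr_sym x y : R0 x y -> frac_corr psi phi y x.
Proof. by move=> [h1 [h2 [h20 xE yE]]]; exists h1, h2; split=> //; apply: ev_neq0. Qed.

Lemma frac_corr_ev h : R0 (ev1 h) (ev2 h).
Proof. by exists h, [:: (1, 1)]; rewrite !fev_one !mulr1 oner_neq0. Qed.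

Lemma frac_corrB x y x' y' : R0 x y -> R0 x' y' -> R0 (x - x') (y - y').
Proof.
move=> [h1 [h2 [h20 xE yE]]] [g1 [g2 [g20 x'E y'E]]].
exists (fmul h1 g2 ++ fopp (fmul g1 h2)), (fmul h2 g2).
rewrite !fev_cat !fev_opp !fev_mul mulf_neq0 // -xE -yE -x'E -y'E; split=> //.
  by rewrite mulrBl mulrA; congr (_ - _); rewrite -!mulrA [ev1 h2 * _]mulrC.
by rewrite mulrBl mulrA; congr (_ - _); rewrite -!mulrA [ev2 h2 * _]mulrC.
Qed.

Lemma frac_corrM x y x' y' : R0 x y -> R0 x' y' -> R0 (x * x') (y * y').
Proof.
move=> [h1 [h2 [h20 xE yE]]] [g1 [g2 [g20 x'E y'E]]].
exists (fmul h1 g1), (fmul h2 g2).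
rewrite !fev_mul mulf_neq0 // -xE -yE -x'E -y'E; split=> //.
  exact: mulrACA.
exact: mulrACA.
Qed.

Lemma frac_corrX x y n : R0 x y -> R0 (x ^+ n) (y ^+ n).
Proof.
move=> xy; elim: n => [|n IH]; last by rewrite !exprS; apply: frac_corrM.
by have := frac_corr_ev [:: (1, 1)]; rewrite !fev_one.
Qed.

Lemma frac_corr_div x y h : ev1 h != 0 -> R0 x y -> R0 (x / ev1 h) (y / ev2 h).
Proof.
move=> h0 [h1 [h2 [h20 xE yE]]]; exists h1, (fmul h h2).
rewrite !fev_mul mulf_neq0 // !mulrA !divfK ?ev_neq0 //.
Qed.

Lemma frac_corr0 y : R0 0 y -> y = 0.
Proof.
move=> [h1 [h2 [h20 /esym]]]; rewrite mul0r => /le -> /eqP.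
by rewrite mulf_eq0 (negPf (ev_neq0 h20)) orbF => /eqP.
Qed.

Lemma frac_corr_ider x y i : R0 x y -> R0 (ider i x) (ider i y).
Proof.
move=> xy; have [h1 [h2 [h20 xE yE]]] := xy; have h20' := ev_neq0 h20.
elim/ltn_ind: i => i IH.
have := iderM i x (ev1 h2); have := iderM i y (ev2 h2).
rewrite xE yE !big_ord_recr subnn !ider0 /=.
move=> /eqP; rewrite addrC -subr_eq => /eqP Ey /eqP; rewrite addrC -subr_eq => /eqP Ex.
rewrite -(mulfK h20 (ider i x)) -(mulfK h20' (ider i y)) -Ex -Ey.
apply: frac_corr_div => //; apply: frac_corrB.
  by rewrite phi_der psi_der; apply: frac_corr_ev.
apply: (big_ind2 R0).
- by have := frac_corr_ev [::]; rewrite !fev_nil.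
- move=> u v u' v' uv u'v'; rewrite -[u']opprK -[v']opprK; apply: frac_corrB => //.
  rewrite -[- u']sub0r -[- v']sub0r; apply: frac_corrB => //.
  by have := frac_corr_ev [::]; rewrite !fev_nil.
- move=> l _; apply: frac_corrM; first exact: IH.
  by rewrite phi_der psi_der; apply: frac_corr_ev.
Qed.

Lemma corr_sym x y : R x y -> corr psi phi y x.
Proof. by move=> [n /frac_corr_sym yx]; exists n. Qed.

Lemma corr_raise x y n m : R0 (x ^+ (p ^ n)) (y ^+ (p ^ n)) ->
  R0 (x ^+ (p ^ (n + m))) (y ^+ (p ^ (n + m))).
Proof. by rewrite expnD !exprM; apply: frac_corrX. Qed.

Lemma corrB x y x' y' : R x y -> R x' y' -> R (x - x') (y - y').
Proof.
move=> [n xy] [m x'y']; exists (n + m)%N.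
have pn : [char U].-nat (p ^ (n + m))%N.
  by rewrite (eq_pnat _ (pcharf_eq U_char)) pnatX pnat_id.
rewrite !exprDn_pchar // !exprNn_pchar //.
by apply: frac_corrB; [apply: corr_raise|rewrite addnC; apply: corr_raise].
Qed.

Lemma corrM x y x' y' : R x y -> R x' y' -> R (x * x') (y * y').
Proof.
move=> [n xy] [m x'y']; exists (n + m)%N; rewrite !exprMn.
by apply: frac_corrM; [apply: corr_raise|rewrite addnC; apply: corr_raise].
Qed.

Lemma corr0 y : R 0 y -> y = 0.
Proof.
move=> [n]; rewrite expr0n expn_eq0 (gtn_eqF (prime_gt0 p_prime)) => /frac_corr0 /eqP.
by rewrite expf_eq0 => /andP[_ /eqP].
Qed.

Lemma corr_ider x y i : R x y -> R (ider i x) (ider i y).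
Proof.
move=> [n xy]; exists n; have := frac_corr_ider (p ^ n * i) xy.
rewrite !(ider_frobenius _ _ _ U_char) dvdn_mulr // mulKn //.
by rewrite expn_gt0 prime_gt0.
Qed.

Lemma corr_base x : x \in F -> R x x.
Proof.
move=> xF; exists 0; rewrite !expr1.
by have := frac_corr_ev [:: ((Sub x xF : FT), 1)]; rewrite !fev_const.
Qed.

Lemma corr_fun x y y' : R x y -> R x y' -> y = y'.
Proof.
move=> xy /(corrB xy); rewrite subrr => /corr0/eqP.
by rewrite subr_eq0 => /eqP.
Qed.

(** The image of [x ^+ (p ^ n)] needs a [p ^ n]-th root in [U]: its derivatives of positive order
    below [p ^ n] vanish, because those of [x ^+ (p ^ n)] do and the correspondence respects
    derivations. *)
Lemma corr_total x n : x ^+ (p ^ n) \in frac_pred phi ->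
  exists y, R x y /\ y ^+ (p ^ n) \in frac_pred psi.
Proof.
move=> /frac_predP[h1 [h2 [h20 xE]]]; have h20' := ev_neq0 h20.
pose y0 := ev2 h1 / ev2 h2.
have xy0 : R0 (x ^+ (p ^ n)) y0 by exists h1, h2; rewrite divfK.
have [|y yE] := frobenius_root U_SCH (n := n) (x := y0).
  move=> i /andP[i0 ip]; apply: frac_corr0; have := frac_corr_ider i xy0.
  by rewrite (ider_frobenius _ _ _ U_char) gtnNdvd.
exists y; rewrite -yE; split; first by exists n; rewrite -yE.
by apply/frac_predP; exists h1, h2; rewrite divfK.
Qed.

End Closure.

Lemma corr_isomorphism (phi psi : ahom A UA) (K L : idSubfield U) :
  relations_le phi psi -> relations_le psi phi -> derives phi -> derives psi ->
  (forall x, x \in K <-> exists n, x ^+ (p ^ n) \in frac_pred phi) ->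
  (forall x, x \in L <-> exists n, x ^+ (p ^ n) \in frac_pred psi) ->
  idIsomorphic_over F K L.
Proof.
move=> le ge phi_der psi_der KE LE.
have /choice[s sE] (x : subfieldType K) :
    exists y : subfieldType L, corr phi psi (val x) (val y).
  have [n xn] := (KE (val x)).1 (valP x).
  have [y [xy yn]] := corr_total le ge phi_der psi_der xn.
  have yL : y \in L by apply/LE; exists n.
  by exists (Sub y yL).
have /choice[t tE] (y : subfieldType L) :
    exists x : subfieldType K, corr phi psi (val x) (val y).
  have [n yn] := (LE (val y)).1 (valP y).
  have [x [yx xn]] := corr_total ge le psi_der phi_der yn.
  have xK : x \in K by apply/KE; exists n.
  by exists (Sub x xK); apply: corr_sym yx.
have fun_r x (y : subfieldType L) : corr phi psi (val x) (val y) -> s x = y.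
  by move=> xy; apply: val_inj; apply: (corr_fun le ge (sE x) xy).
have fun_l (x : subfieldType K) y : corr phi psi (val x) (val y) -> t y = x.
  move=> xy; apply: val_inj.
  exact: (corr_fun ge le (corr_sym ge (tE y)) (corr_sym ge xy)).
have s_zmod : zmod_morphism s.
  by move=> x y; apply: fun_r; rewrite !rmorphB; apply: (corrB (sE x) (sE y)).
have s_monoid : monoid_morphism s.
  split=> [|x y]; apply: fun_r; rewrite ?rmorph1 ?rmorphM.
    by apply: corr_base; apply: rpred1.
  exact: (corrM (sE x) (sE y)).
pose sZ := GRing.isZmodMorphism.Build _ _ s s_zmod.
pose sM := GRing.isMonoidMorphism.Build _ _ s s_monoid.
pose sR : {rmorphism subfieldType K -> subfieldType L} := HB.pack s sZ sM.
exists sR; split.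
- by exists t => [x|y]; [apply: fun_l; apply: sE|apply: fun_r; apply: tE].
- by move=> i x; apply: fun_r; apply: (corr_ider ge phi_der psi_der i (sE x)).
- move=> x xF; by apply: (corr_fun le ge (sE x)); apply: corr_base.
Qed.

End Correspondence.

Section Uniqueness.
Variables (p : nat) (U : idFieldType) (U_SCH : SCH p U) (F : idSubfield U).
Local Notation k := (subfieldType (constantField F)).
Local Notation FT := (subfieldType F).
Local Notation UA := (univ_alg F).
Local Notation kk := (Alg (idfun : {rmorphism k -> k})).
Local Notation vF := (val : {rmorphism FT -> U}).
Hypothesis k_closed : has_roots k.
Variables (G : algebraic_group k) (alpha : arc_bundle G (base_alg F)).
Hypothesis alpha_e : arc_e alpha.

Lemma const_pointM (w w' : gobj G kk) (A : alg k) :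
  const_point (w * w')%g A = (const_point w A * const_point w' A)%g.
Proof. exact: gmapM. Qed.

Lemma constants_have_roots (K : idSubfield U) (FK : {subset F <= K}) :
  constants K =i constants F -> has_roots (subfieldType (constantField K)).
Proof.
move=> KF; have KFs : {subset constantField K <= constantField F}.
  by move=> x; rewrite -[x \in constantField F]KF.
move=> q q1; have [|r qr] := k_closed (q := map_poly (sub_incl KFs) q).
  by rewrite size_map_poly.
exists (const_incl FK r); rewrite -(fmorph_root (sub_incl KFs)).
by rewrite [X in root _ X](_ : _ = r) //; apply: val_inj.
Qed.

(** Here [O = U] and the point to be moved is [b] itself, at which all derivatives of its relations
    vanish. The constant factor is a point over [k] because [K] has no new constants. *)
Lemma specializes_to_translate (K : idSubfield U) (FK : {subset F <= K})
    (a0 : gobj G (Alg (field_incl FK))) (b : gobj G UA) :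
  constants K =i constants F -> solves alpha (gmap (subfield_hom FK) a0) ->
  solves alpha b ->
  exists w : gobj G kk, spec b (gmap (subfield_hom FK) a0 * const_point w UA)%g.
Proof.
move=> KF a_sol b_sol.
have [_ [nch [ch [u [ch_ok cover]]]]] := ag_variety G.
have [i [phi phiE]] := cover U (val : {rmorphism k -> U}) b.
have [_ _ u_open] := ch_ok i; rewrite -[b]phiE in b_sol *.
have [d dE] := uniform_derivative alpha_e u_open.
pose jO : {rmorphism subfieldType K -> U} := val.
pose phi0 : ahom (ch i) (Alg (jO \o field_incl FK)) :=
  @AHom k (ch i) (Alg (jO \o field_incl FK)) phi (ahom_str phi).
have [c0 [Phi [PhiE _ PhiF]]] := translate_to_constants k_closed
  (constants_have_roots FK KF) a_sol u_open dE phi0.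
have KFs : {subset constantField K <= constantField F}.
  by move=> x; rewrite -[x \in constantField F]KF.
have DkE c : sub_incl KFs (const_incl FK c) = c by apply: val_inj.
pose Dk : ahom (Alg (const_incl FK)) kk := @AHom k (Alg (const_incl FK)) kk (sub_incl KFs) DkE.
exists (gmap Dk c0).
have -> : (gmap (subfield_hom FK) a0 * const_point (gmap Dk c0) UA)%g = gmap Phi (u i).
  rewrite PhiE gmapM; congr (_ * _)%g; rewrite /const_point -!gmap_comp.
  by congr (gmap _ _); apply: ahom_ext.
apply: (relations_spec u_open) => h h0; apply: PhiF => m.
have {}dE := dformE (dE phi b_sol).
transitivity (fev vF phi (dform d m h)); first exact: eq_fev.
by rewrite -dE h0 raddf0.
Qed.

Lemma solves_const_point (a : gobj G UA) (w : gobj G kk) :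
  solves alpha a -> solves alpha (a * const_point w UA)%g.
Proof.
move=> a_sol; apply: solves_mul => //; apply: (nabla_constant (A := kk)).
by move=> t i i0; have /constantsP[_] := valP t; apply.
Qed.

(** A point over the field of [phi] times a point over [k] is a point over that field, and
    [affine_open_descent] places its coordinates there. *)
Lemma frac_translate (A A' : alg k) (u : points G A) (u' : points G A')
    (phi : ahom A UA) (phi' : ahom A' UA) (w : gobj G kk) :
  affine_open u -> affine_open u' -> solves alpha (gmap phi u) ->
  gmap phi' u' = (gmap phi u * const_point w UA)%g ->
  {subset frac_pred phi' <= frac_pred phi}.
Proof.
move=> u_open u'_open sol phi'E.
have [d dE] := uniform_derivative alpha_e u_open.
pose K := frac_idSubfield (dformE (dE phi sol)).
have FK : {subset F <= K} by apply: sub_frac.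
have [phi0 phi0E] := factor_subfield FK (psi := phi) (chart_frac phi).
have rhoE c : (val : {rmorphism subfieldType K -> U}) (field_incl FK c) =
  (val : {rmorphism k -> U}) c by [].
have E : gmap phi' u' = gmap (field_hom rhoE)
    (gmap phi0 u * const_point w (Alg (field_incl FK)))%g.
  rewrite gmapM gmap_const_point phi'E; congr (_ * _)%g.
  by apply: esym; apply: gmapE.
have [phi1 phi1E] := affine_open_descent u'_open E.
have phi'K t : phi' t \in K.
  suff -> : phi' t = val (phi1 t) by apply: valP.
  apply: (u'_open.1 _ phi' (ahom_comp (field_hom rhoE) phi1)).
  by rewrite [RHS]fmap_comp phi1E -[RHS]E.
move=> x /frac_predP[h1 [h2 [h20 xE]]].
have evK h : fev vF phi' h \in K.
  by apply: rpred_sum => y _; apply: rpredM => //; apply: (FK _ (valP y.1)).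
suff: x \in K by [].
by rewrite -(mulfK h20 x) xE rpred_div.
Qed.

Theorem idGalois_extension_unique (K L : idSubfield U) :
  idGalois_extension p alpha K -> idGalois_extension p alpha L ->
  idIsomorphic_over F K L.
Proof.
move=> [a [a_sol KE KC]] [b [b_sol LE LC]].
have [_ [nch [ch [u [ch_ok cover]]]]] := ag_variety G.
have {}cover g : exists i, exists phi : ahom (ch i) UA, gmap phi (u i) = g.
  exact: (cover U (val : {rmorphism k -> U})).
have {ch_ok}u_open i : affine_open (u i) by have [] := ch_ok i.
have der i := uniform_derivative alpha_e (u_open i).
have memK (M : idSubfield U) g i (phi : ahom (ch i) UA) : solves alpha g ->
    [set` M] = proot_closure p (idgen ([set` F] `|` coordinates (X := points G) g)) ->
    gmap phi (u i) = g ->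
    forall x, x \in M <-> exists n, x ^+ (p ^ n) \in frac_pred phi.
  move=> g_sol ME phiE x; have [d dE] := der i; rewrite -phiE in g_sol ME.
  rewrite (idgen_frac (dformE (dE phi g_sol)) (u_open i)) in ME.
  by have := congr1 (fun S : set U => S x) ME => /= ->.
have lift (M : idSubfield U) g : solves alpha g ->
    [set` M] = proot_closure p (idgen ([set` F] `|` coordinates (X := points G) g)) ->
    exists (FM : {subset F <= M}) (g0 : gobj G (Alg (field_incl FM))),
      gmap (subfield_hom FM) g0 = g.
  move=> g_sol ME; have [i [phi phiE]] := cover g.
  have Mfrac := memK M g i phi g_sol ME phiE.
  have FM : {subset F <= M}.
    by move=> x xF; apply/Mfrac; exists 0; apply: sub_frac.
  have phiM t : phi t \in M by apply/Mfrac; exists 0; apply: chart_frac.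
  have [phi0 phi0E] := factor_subfield FM phiM.
  by exists FM, (gmap phi0 (u i)); rewrite -phiE; apply: gmapE.
have [FK [a0 a0E]] := lift K a a_sol KE.
have [FL [b0 b0E]] := lift L b b_sol LE.
have [w sw] : exists w : gobj G kk, spec b (a * const_point w UA)%g.
  by rewrite -a0E in a_sol *; apply: specializes_to_translate.
have [w' sw'] : exists w' : gobj G kk, spec a (b * const_point w' UA)%g.
  by rewrite -b0E in b_sol *; apply: specializes_to_translate.
set a1 := (a * const_point w UA)%g in sw.
have a1_sol : solves alpha a1 by apply: solves_const_point.
pose v := (w' * w)%g.
have a1b : spec a1 (b * const_point v UA)%g.
  by rewrite /v const_pointM mulgA; apply: spec_mul.
have bS : spec b (b * const_point v UA)%g := spec_trans sw a1b.
have bv_b : spec (b * const_point v UA)%g b.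
  (* Translating the step from [b] to [b * v] by powers of [v] gives a chain; where a step reverses,
     translation by [v ^- n] reverses the first one. *)
  have [|n] := spec_noetherian (g := fun n => (b * const_point (v ^+ n) UA)%g).
    move=> n; rewrite expgS const_pointM mulgA.
    exact: spec_mul.
  move/(spec_mul (w := (v ^- n)%g)); rewrite -!mulgA -!const_pointM expgS -mulgA mulgV mulg1.
  have -> : const_point (1 : gobj G kk)%g UA = 1%g by apply: gmap1.
  by rewrite mulg1.
have a1_b : spec a1 b := spec_trans a1b bv_b.
have [i [phi1 phi1E]] := cover a1.
have [phib [phibE le]] := sw _ _ (u_open i) _ phi1E.
have ge : relations_le phi1 phib.
  by apply: (spec_chart (u_open i)); rewrite phi1E phibE.
have [d dE] := der i.
have phi1_sol : solves alpha (gmap phi1 (u i)) by rewrite phi1E.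
have phib_sol : solves alpha (gmap phib (u i)) by rewrite phibE.
apply: (corr_isomorphism U_SCH ge le (dformE (dE phi1 phi1_sol))
  (dformE (dE phib phib_sol))); last exact: memK b_sol LE phibE.
(* [K] is generated by [a], while the relations compared are those of [a * w]; translation by [w]
   and by its inverse shows that both points give the same fractions. *)
move=> x; have [l [phia phiaE]] := cover a.
have phia_sol : solves alpha (gmap phia (u l)) by rewrite phiaE.
rewrite (memK K a l phia a_sol KE phiaE).
have sub1 : {subset frac_pred phi1 <= frac_pred phia}.
  by apply: (frac_translate (w := w) (u_open l) (u_open i)) => //; rewrite phiaE phi1E.
have sub2 : {subset frac_pred phia <= frac_pred phi1}.
  apply: (frac_translate (w := w^-1%g) (u_open i) (u_open l)) => //.
  rewrite phiaE phi1E /a1 -mulgA -const_pointM mulgV.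
  have -> : const_point (1 : gobj G kk)%g UA = 1%g by apply: gmap1.
  by rewrite mulg1.
by split=> -[n xn]; exists n; [apply: sub2|apply: sub1].
Qed.

End Uniqueness.

Theorem theorem4p12 (p : nat) (p_prime : prime p)
    (U : idFieldType) (U_SCH : SCH p U) (U_saturated : saturated U)
    (F : idSubfield U) (F_small : smaller [set` F])
    (F_nontrivial : exists x, x \in F /\ ider 1 x <> 0)
    (F_dcl : dcl p [set` F] = [set` F])
    (CF_closed : GRing.closed_field_axiom (subfieldType (constantField F)))
    (G : algebraic_group (subfieldType (constantField F)))
    (alpha : arc_bundle G (base_alg F)) (alpha_e : arc_e alpha)
    (alpha_consistent : consistent alpha) :
  (exists K : idSubfield U, idGalois_extension p alpha K) /\
  (forall K L : idSubfield U,
     idGalois_extension p alpha K -> idGalois_extension p alpha L ->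
     idIsomorphic_over F K L).
Proof.
have k_closed := closed_has_roots CF_closed; split.
  exact: idGalois_extension_exists.
by move=> K L; apply: idGalois_extension_unique.
Qed.
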